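(* Let $\boldsymbol\theta=(\vartheta_1,\ldots,\vartheta_p)$ be the vector of model parameters, on which the generator blocks $\mathbf Q^{[n,n']}(\boldsymbol\theta)$ depend differentiably. Let $\mathcal{A}\subseteq\{0,1,\ldots,N\}$ and let $s\in\mathbb{C}$ with $\mathrm{Re}(s)\ge 0$ (such that the inverses displayed below exist). For $0\le n\le N-1$ and $2\le k\le N-n$, $$\frac{\partial}{\partial\boldsymbol\theta}\widetilde{\mathbf C}_{\mathcal{A}}^{n,n+k}(s;\boldsymbol\theta)=\frac{\partial \widetilde{\mathbf C}_{\mathcal{A}}^{n,n+k-1}(s;\boldsymbol\theta)}{\partial\boldsymbol\theta}\left(\mathbf I_p\otimes\widetilde{\mathbf C}_{\mathcal{A}}^{n+k-1,n+k}(s;\boldsymbol\theta)\right)+\widetilde{\mathbf C}_{\mathcal{A}}^{n,n+k-1}(s;\boldsymbol\theta)\,\frac{\partial\widetilde{\mathbf C}_{\mathcal{A}}^{n+k-1,n+k}(s;\boldsymbol\theta)}{\partial\boldsymbol\theta},$$ where, with $\mathbf M_0=\mathbf Q^{[0,0]}(\boldsymbol\theta)-s\,\mathbf C_0\,I(0\in\mathcal{A})$, $$\frac{\partial}{\partial\boldsymbol\theta}\widetilde{\mathbf C}_{\mathcal{A}}^{0,1}(s;\boldsymbol\theta)=\mathbf M_0^{-1}\,\frac{\partial\mathbf Q^{[0,0]}(\boldsymbol\theta)}{\partial\boldsymbol\theta}\left(\mathbf I_p\otimes\mathbf M_0^{-1}\right)\left(\mathbf I_p\otimes\mathbf Q^{[0,1]}(\boldsymbol\theta)\right)-\mathbf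 M_0^{-1}\,\frac{\partial\mathbf Q^{[0,1]}(\boldsymbol\theta)}{\partial\boldsymbol\theta},$$ and for $m=1,\ldots,n+k-1$, with $\mathbf M_m=\mathbf Q^{[m,m]}(\boldsymbol\theta)-s\,\mathbf C_m\,I(m\in\mathcal{A})+\mathbf Q^{[m,m-1]}(\boldsymbol\theta)\,\widetilde{\mathbf C}_{\mathcal{A}}^{m-1,m}(s;\boldsymbol\theta)$, $$\begin{aligned}\frac{\partial}{\partial\boldsymbol\theta}\widetilde{\mathbf C}_{\mathcal{A}}^{m,m+1}(s;\boldsymbol\theta)={}&\mathbf M_m^{-1}\left(\frac{\partial\mathbf Q^{[m,m]}(\boldsymbol\theta)}{\partial\boldsymbol\theta}+\frac{\partial\mathbf Q^{[m,m-1]}(\boldsymbol\theta)}{\partial\boldsymbol\theta}\left(\mathbf I_p\otimes\widetilde{\mathbf C}_{\mathcal{A}}^{m-1,m}(s;\boldsymbol\theta)\right)+\mathbf Q^{[m,m-1]}(\boldsymbol\theta)\,\frac{\partial\widetilde{\mathbf C}_{\mathcal{A}}^{m-1,m}(s;\boldsymbol\theta)}{\partial\boldsymbol\theta}\right)\\&\times\left(\mathbf I_p\otimes\mathbf M_m^{-1}\right)\left(\mathbf I_p\otimes\mathbf Q^{[m,m+1]}(\boldsymbol\theta)\right)-\mathbf M_m^{-1}\,\frac{\partial\mathbf Q^{[m,m+1]}(\boldsymbol\theta)}{\partial\boldsymbol\theta}.\end{aligned}$$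
   Context: Level-dependent quasi-birth-and-death process (LD-QBD): a continuous-time Markov chain $\{(X(t),\varphi(t)):t\ge 0\}$ on the finite state space $\mathcal{S}=\{(n,i): n=0,1,\ldots,N;\ i=0,1,\ldots,K_n\}$, with level $X(t)$ and phase $\varphi(t)$, such that each transition changes the level by at most one. Its generator $\mathbf Q=\mathbf Q(\boldsymbol\theta)$ (for each value of the real parameter vector $\boldsymbol\theta$ in an open set) has off-diagonal entries the transition rates $q_{(n,i)\to(n',j)}$ and diagonal entries $q_{(n,i)\to(n,i)}=-\sum_{(n',j)\ne(n,i)}q_{(n,i)\to(n',j)}$. It is block tridiagonal with blocks $\mathbf Q^{[n,n']}=[q_{(n,i)\to(n',j)}]_{i=0,\ldots,K_n;\,j=0,\ldots,K_{n'}}$, which are zero if $|n-n'|>1$ and may depend on $n$. Costs accrue at rate $c(n,i)\ge 0$ (not depending on $\boldsymbol\theta$) per unit time in state $(n,i)$; $\mathbf C_n=\mathrm{diag}(c(n,i))_{i}$. $I(\cdot)$ is the indicator ($1$ if the condition is true, $0$ otherwise). For a set of levels $\mathcal{A}\subseteq\{0,\ldots,N\}$, $$C_{\mathcal{A}}(t)=\int_0^t c(X(u),\varphi(u))\,I(X(u)\in\mathcal{A})\,du$$ is the total cost accumulated in $\mathcal A$ up to time $t$. The first hitting time of level $m$ is $\theta_m=\inf\{t>0: X(t)=m\}$. For $1\le k\le N-n$, $\widetilde{\mathbf C}_{\mathcal{A}}^{n,n+k}(s)=\widetilde{\mathbf C}_{\mathcal{A}}^{n,n+k}(s;\boldsymbol\theta)=[\widetilde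 C_{\mathcal{A};ij}^{n,n+k}(s)]_{i=0,\ldots,K_n;\,j=0,\ldots,K_{n+k}}$ is the matrix of Laplace–Stieltjes transforms $$\widetilde C_{\mathcal{A};ij}^{n,n+k}(s)=\int_{0}^{\infty}e^{-sz}\,c^{n,n+k}_{\mathcal{A};i,j}(z)\,dz,$$ $$c^{n,n+k}_{\mathcal{A};i,j}(z)=\frac{\partial}{\partial z}\mathbb P\big(C_{\mathcal{A}}(\theta_{n+k})\le z,\ \varphi(\theta_{n+k})=j\mid X(0)=n,\varphi(0)=i\big),$$ where the density is understood in the generalized sense (the distribution may have an atom at $0$), i.e. $\widetilde C_{\mathcal{A};ij}^{n,n+k}(s)=\mathbb E\big[e^{-sC_{\mathcal{A}}(\theta_{n+k})}I(\theta_{n+k}<\infty,\varphi(\theta_{n+k})=j)\mid X(0)=n,\varphi(0)=i\big]$, computed for the process with generator $\mathbf Q(\boldsymbol\theta)$. For a matrix function $\mathbf A(\boldsymbol\theta)$ of $\boldsymbol\theta=(\vartheta_1,\ldots,\vartheta_p)$, $\frac{\partial\mathbf A(\boldsymbol\theta)}{\partial\boldsymbol\theta}=\left[\frac{\partial\mathbf A}{\partial\vartheta_1}\ \cdots\ \frac{\partial\mathbf A}{\partial\vartheta_p}\right]$ is the horizontal concatenation of the entrywise partial derivatives; $\mathbf I_p$ is the $p\times p$ identity matrix and $\otimes$ is the Kronecker product. *)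

(* Defs.v *)
From HB Require Import structures.
From mathcomp Require Import all_boot all_order all_algebra.
From mathcomp Require Import all_classical all_reals all_analysis.
From mathcomp Require Import complex mxtens.

Set Implicit Arguments.
Unset Strict Implicit.
Unset Printing Implicit Defensive.

Import Order.TTheory GRing.Theory Num.Theory.
Import numFieldNormedType.Exports.

Local Open Scope classical_set_scope.
Local Open Scope ring_scope.
Local Open Scope complex_scope.

(** Pairs [(n, i)] with [n] in {0, ..., N} and [i] in {0, ..., K n}; the values
    of [K] beyond [N] play no role. *)
Definition state (N : nat) (K : nat -> nat) : finType :=
  {n : 'I_N.+1 & 'I_(K n).+1}.

Definition level N K (x : state N K) : 'I_N.+1 := tag x.

(** The state [(n, i)] for a natural number [n <= N].  Levels are natural numbers
    in the matrix notation, so that blocks of adjacent levels compose without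
    casts; both [inord] are value-preserving when [n <= N], and no other [n] is
    ever used. *)
Definition st N K (n : nat) (i : 'I_(K n).+1) : state N K :=
  @Tagged 'I_N.+1 (inord n) (fun l => 'I_(K l).+1) (inord i).

Definition qbd_generator (R : realType) N K (Q : state N K -> state N K -> R) :=
  [/\ forall x y, x != y -> 0 <= Q x y,
      forall x, Q x x = - \sum_(y | y != x) Q x y
    & forall x y, ((level x).+1 < level y)%N || ((level y).+1 < level x)%N ->
        Q x y = 0].

(** [Pt t x y] is the probability of being in [y] a time [t] after being in [x];
    [Q] is the derivative of the semigroup [Pt] at time 0. *)
Definition transition_semigroup (R : realType) (S : finType)
    (Pt : R -> S -> S -> R) (Q : S -> S -> R) : Prop :=
  [/\ forall t x y, 0 <= t -> 0 <= Pt t x y,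
      forall t x, 0 <= t -> \sum_y Pt t x y = 1,
      forall x y, Pt 0 x y = (x == y)%:R,
      forall t u x y, 0 <= t -> 0 <= u ->
        Pt (t + u) x y = \sum_z Pt t x z * Pt u z y
    & forall x y,
        (Pt h x y - (x == y)%:R) / h @[h --> (0 : R)^'+] --> Q x y].

(** [Z] under the family of laws [P], where [P x] is the conditional law given
    [Z 0 = x].  Only times [t >= 0] matter.  The last clause is the Markov
    property, with the conditioning multiplied out so that past events of
    probability 0 need no convention. *)
Definition markov_chain (R : realType) (S : finType) (d : measure_display)
    (T : measurableType d) (P : S -> probability T R) (Z : R -> T -> S)
    (Q : S -> S -> R) : Prop :=
  [/\ forall t x, 0 <= t -> measurable [set w | Z t w = x],
      forall w t, 0 <= t -> \forall u \near t^'+, Z u w = Z t w,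
      forall x, P x [set w | Z 0 w = x] = 1%E
    & exists2 Pt : R -> S -> S -> R, transition_semigroup Pt Q &
        forall (x0 : S) (r : nat) (t : nat -> R) (x : nat -> S) (u : R) (y : S),
          0 <= t 0%N -> (forall l, t l < t l.+1) -> 0 <= u ->
          P x0 [set w | (forall l, (l <= r)%N -> Z (t l) w = x l) /\
                        Z (t r + u) w = y] =
          (P x0 [set w | forall l, (l <= r)%N -> Z (t l) w = x l] *
             (Pt u (x r) y)%:E)%E].

Definition cexp (R : realType) (z : R[i]) : R[i] :=
  (expR (complex.Re z) * cos (complex.Im z)) +i*
  (expR (complex.Re z) * sin (complex.Im z)).

Definition cexpectation (R : realType) (d : measure_display)
    (T : measurableType d) (P : probability T R) (X : T -> R[i]) : R[i] :=
  fine ('E_P[fun w => complex.Re (X w)])%E +i*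
  fine ('E_P[fun w => complex.Im (X w)])%E.

Section Cost.
Variables (R : realType) (N : nat) (K : nat -> nat).
Variables (d : measure_display) (T : measurableType d).
Variables (P : state N K -> probability T R) (Z : R -> T -> state N K).
Variables (c : state N K -> R) (A : {set 'I_N.+1}).

Definition cost (t : R) (w : T) : R :=
  \int[lebesgue_measure]_(u in `[0, t])
    (c (Z u w) * (level (Z u w) \in A)%:R).

Definition hitting_time (m : nat) (w : T) : \bar R :=
  ereal_inf [set t%:E | t in [set t : R | 0 < t /\ level (Z t w) = m :> nat]].

(** Laplace-Stieltjes transforms of the (defective) laws of the cost accumulated
    until level [m] is reached, written as expectations because these laws may
    have an atom at 0. *)
Definition lst (s : R[i]) (n m : nat) : 'M[R[i]]_((K n).+1, (K m).+1) :=
  \matrix_(i, j) cexpectation (P (st N i)) (fun w =>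
    if (hitting_time m w < +oo)%E then
      let tau := fine (hitting_time m w) in
      cexp (- (s * (cost tau w)%:C)) * (Z tau w == st N j)%:R
    else 0).

End Cost.

Section Blocks.
Variables (R : realType) (N : nat) (K : nat -> nat).
Variables (Q : state N K -> state N K -> R).
Variables (c : state N K -> R) (A : {set 'I_N.+1}) (s : R[i]).

Definition Qblock (n n' : nat) : 'M[R[i]]_((K n).+1, (K n').+1) :=
  \matrix_(i, j) (Q (st N i) (st N j))%:C.

Definition Cblock (n : nat) : 'M[R[i]]_((K n).+1) :=
  diag_mx (\row_i (c (st N i))%:C).

(** The matrices [M_0] and [M_m], [m >= 1], where [L m' m'.+1] stands for the
    transform matrix between these levels. *)
Definition Mblock
    (L : forall n n' : nat, 'M[R[i]]_((K n).+1, (K n').+1)) (m : nat) :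
    'M[R[i]]_((K m).+1) :=
  let B m := Qblock m m - (s * (inord m \in A)%:R) *: Cblock m in
  match m with
  | 0%N => B 0%N
  | m'.+1 => B m'.+1 + Qblock m'.+1 m' *m L m' m'.+1
  end.

End Blocks.

Section MatrixDerivative.
Variables (R : realType) (p a b : nat).
Variable (F : 'rV[R]_p -> 'M[R[i]]_(a, b)).

Definition mx_derivable (th : 'rV[R]_p) : Prop :=
  forall (r : 'I_p) i j,
    derivable (fun t => complex.Re (F t i j) : R) th (delta_mx 0 r) /\
    derivable (fun t => complex.Im (F t i j) : R) th (delta_mx 0 r).

Definition mx_partial (r : 'I_p) (th : 'rV[R]_p) : 'M[R[i]]_(a, b) :=
  \matrix_(i, j)
    ('D_(delta_mx 0 r) (fun t => complex.Re (F t i j) : R) th +i*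
     'D_(delta_mx 0 r) (fun t => complex.Im (F t i j) : R) th).

(** Horizontal concatenation of the [p] partial derivatives: column [r * b + j]
    is column [j] of the [r]-th one, the column order of the Kronecker product
    [*t]. *)
Definition mx_deriv (th : 'rV[R]_p) : 'M[R[i]]_(a, p * b) :=
  \matrix_(i, l) mx_partial (mxtens_unindex l).1 th i (mxtens_unindex l).2.

End MatrixDerivative.

Definition Ikron (R : realType) (p a b : nat) (B : 'M[R[i]]_(a, b)) :
    'M[R[i]]_(p * a, p * b) := (1%:M : 'M[R[i]]_p) *t B.

(* Main.v *)
Require Import Defs.
From HB Require Import structures.
From mathcomp Require Import all_boot all_order all_algebra.
From mathcomp Require Import all_classical all_reals all_analysis.
From mathcomp Require Import complex mxtens ring lra measurable_realfun.

Set Implicit Arguments.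
Unset Strict Implicit.
Unset Printing Implicit Defensive.

Import Order.TTheory GRing.Theory Num.Theory.
Import numFieldNormedType.Exports.

Local Open Scope classical_set_scope.
Local Open Scope ring_scope.
Local Open Scope complex_scope.

(** Sample the chain at the times [h], [2h], ...: for the sampled chain the
    transforms satisfy an exact one-step recursion.  Let [h] tend to 0.  Since a
    path is only right-continuous, the accumulated cost is approximated by
    right-endpoint Riemann sums, which then converge on every path, as do the
    sampled hitting times and places.  By dominated convergence the transforms
    are harmonic for [Q - s C] off the target level, with the identity as
    boundary values.  Block Gaussian elimination of these linear equations gives
    both [M_m L_(m,m+1) = - Q_(m,m+1)] and [L_(n,m+1) = L_(n,m) L_(m,m+1)] as
    soon as the [M_l] are invertible, without the strong Markov property.
    Invertibility persists near [th0], so the product rule applies. *)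

(** * Componentwise limits of complex sequences *)

(** The Markov hypothesis speaks of finitely many deterministic times under one law [P x0]. It
    offers neither shifted laws nor random times, so the starting states are related only through
    the numbers [Pt h x y], and this is what the grid can exploit. A functional of finitely many
    samples is clearly measurable; the hitting functional is measurable because it is a pointwise
    limit of such functionals. The condition Re s >= 0 keeps all of them in the unit disc, so the
    constant 1 dominates whenever a limit of expectations is taken.

    The spaces [T th] for different [th] are unrelated, so no regularity in the parameters can be
    read off the process. It has to come from the algebra: L_(m,m+1) = - M_m^(-1) Q_(m,m+1) must
    hold on a whole neighbourhood of [th0], while the M_m are assumed invertible at [th0] alone. As
    M_m contains L_(m-1,m), differentiability and invertibility nearby have to be established
    together, one level after the other. *)

Section ComplexSequences.
Variable R : realType.
Implicit Types (u v : nat -> R[i]) (x y z l : R[i]).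

Lemma ReD x y : complex.Re (x + y) = complex.Re x + complex.Re y.
Proof. by case: x; case: y. Qed.
Lemma ImD x y : complex.Im (x + y) = complex.Im x + complex.Im y.
Proof. by case: x; case: y. Qed.
Lemma ReM x y : complex.Re (x * y) =
  complex.Re x * complex.Re y - complex.Im x * complex.Im y.
Proof. by case: x; case: y. Qed.
Lemma ImM x y : complex.Im (x * y) =
  complex.Re x * complex.Im y + complex.Im x * complex.Re y.
Proof. by case: x; case: y. Qed.
Lemma ReIm_eq x y :
  complex.Re x = complex.Re y -> complex.Im x = complex.Im y -> x = y.
Proof. by case: x; case: y => a b a' b' /= -> ->. Qed.

Lemma Re_sum (I : finType) (F : I -> R[i]) :
  complex.Re (\sum_i F i) = \sum_i complex.Re (F i).
Proof. exact: (big_morph _ ReD). Qed.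
Lemma Im_sum (I : finType) (F : I -> R[i]) :
  complex.Im (\sum_i F i) = \sum_i complex.Im (F i).
Proof. exact: (big_morph _ ImD). Qed.

Lemma ReIm_le1 z : `|z| <= 1 -> `|complex.Re z| <= 1 /\ `|complex.Im z| <= 1.
Proof.
rewrite normc_def lecR => z1.
by split; apply: le_trans z1; rewrite -sqrtr_sqr ler_sqrt;
  rewrite ?lerDl ?lerDr ?addr_ge0 ?sqr_ge0.
Qed.

Lemma cexp0 : cexp (0 : R[i]) = 1.
Proof. by rewrite /cexp /= expR0 cos0 sin0 mulr1 mulr0. Qed.

Lemma cexpD x y : cexp (x + y) = cexp x * cexp y.
Proof.
case: x => a b; case: y => a' b'; rewrite /cexp /=.
by apply: ReIm_eq => /=; rewrite expRD ?cosD ?sinD; ring.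
Qed.

Lemma norm_cexp z : `|cexp z| = (expR (complex.Re z))%:C.
Proof.
rewrite normc_def /cexp /= !exprMn -mulrDr cos2Dsin2 mulr1 sqrtr_sqr.
by rewrite ger0_norm // expR_ge0.
Qed.

Definition ccvg u (l : R[i]) := (complex.Re (u n) @[n --> \oo] --> complex.Re l) /\
  (complex.Im (u n) @[n --> \oo] --> complex.Im l).

Lemma ccvg_unique u l l' : ccvg u l -> ccvg u l' -> l = l'.
Proof.
move=> [ur ui] [ur' ui']; apply: ReIm_eq.
  exact: (@cvg_unique _ (@Rhausdorff R) _ _ _ _ ur ur').
exact: (@cvg_unique _ (@Rhausdorff R) _ _ _ _ ui ui').
Qed.

Lemma ccvg_cst l : ccvg (fun=> l) l.
Proof. by split; apply: cvg_cst. Qed.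

Lemma ccvgD u v l l' : ccvg u l -> ccvg v l' -> ccvg (fun n => u n + v n) (l + l').
Proof.
move=> [ur ui] [vr vi]; split.
  under eq_fun do rewrite ReD.
  by rewrite ReD; apply: cvgD.
under eq_fun do rewrite ImD.
by rewrite ImD; apply: cvgD.
Qed.

Lemma ccvgM u v l l' : ccvg u l -> ccvg v l' -> ccvg (fun n => u n * v n) (l * l').
Proof.
move=> [ur ui] [vr vi]; split.
  under eq_fun do rewrite ReM.
  by rewrite ReM; apply: cvgB; apply: cvgM.
under eq_fun do rewrite ImM.
by rewrite ImM; apply: cvgD; apply: cvgM.
Qed.

Lemma ccvg_sum (I : finType) (u : I -> nat -> R[i]) (l : I -> R[i]) :
  (forall i, ccvg (u i) (l i)) -> ccvg (fun n => \sum_i u i n) (\sum_i l i).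
Proof.
move=> ul; elim: (index_enum I) => [|i r IH].
  by under eq_fun do rewrite big_nil; rewrite big_nil; apply: ccvg_cst.
under eq_fun do rewrite big_cons.
by rewrite big_cons; apply: ccvgD.
Qed.

Lemma ccvg_real (u : nat -> R) (l : R) :
  (u n @[n --> \oo] --> l) -> ccvg (fun n => (u n)%:C) l%:C.
Proof. by move=> ul; split => //=; apply: cvg_cst. Qed.

Lemma near_ccvg u v l : (\forall n \near \oo, u n = v n) -> ccvg u l -> ccvg v l.
Proof.
move=> uv [ur ui]; split.
  by apply: cvg_trans ur; apply: near_eq_cvg; apply: filterS uv => n ->.
by apply: cvg_trans ui; apply: near_eq_cvg; apply: filterS uv => n ->.
Qed.

Lemma ccvg_cexp (u : nat -> R) (l : R) (s : R[i]) :
  (u n @[n --> \oo] --> l) ->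
  ccvg (fun n => cexp (- (s * (u n)%:C))) (cexp (- (s * l%:C))).
Proof.
move=> ul; case: s => a b; rewrite /cexp /=.
have cE (g : nat -> R) (m : R) (f : R -> R) : continuous f ->
  (g n @[n --> \oo] --> m) -> f (g n) @[n --> \oo] --> f m.
  by move=> cf gm; apply: (@cvg_comp _ _ _ g f _ _ _ gm); exact: cf.
have lr : - (a * u n - b * 0) @[n --> \oo] --> - (a * l - b * 0).
  by apply: cvgN; apply: cvgB; apply: cvgM => //; apply: cvg_cst.
have li : - (a * 0 + b * u n) @[n --> \oo] --> - (a * 0 + b * l).
  by apply: cvgN; apply: cvgD; apply: cvgM => //; apply: cvg_cst.
have er := cE _ _ _ (@continuous_expR R) lr.
by split; apply: cvgM => //; apply: cE => //; [exact: continuous_cos|exact: continuous_sin].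
Qed.

(** The derivative at 0 of the discount factor of one grid step; it produces the term - s C next to
    the generator. *)
Lemma cexp_quotient (a : R[i]) (h : nat -> R) :
  (forall n, 0 < h n) -> (h n @[n --> \oo] --> 0) ->
  ccvg (fun n => (cexp (- (a * (h n)%:C)) - 1) * (h n)^-1%:C) (- a).
Proof.
move=> h0 hl; case: a => a b.
have quo (f : R -> R) (df : R) : is_derive (0 : R) (1 : R) f df ->
    (f (h n) - f 0) / h n @[n --> \oo] --> df.
  move=> [fd <-].
  have /cvgr_dnbhsP /(_ h) H : (f t - f 0) / t @[t --> (0 : R)^'] --> 'D_1 f 0.
    have := fd; rewrite /derivable /derive => {}fd.
    have E : (fun t : R => t^-1 *: (f (t *: 1 + 0) - f 0)) = (fun t : R => (f t - f 0) / t).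
      by apply/funext => t; rewrite addr0 [_ *: 1]mulr1 [_ *: _]mulrC.
    by move: fd; rewrite E.
  by apply: H; split => // n; rewrite gt_eqF.
have ex (k : R) : is_derive (0 : R) (1 : R) (fun h => k * h) k.
  have -> : (fun h : R => k * h) = k \*: (id : R -> R) by [].
  by apply: is_derive_eq; rewrite [_ *: 1]mulr1.
(* The point is left unreduced because the chain rule asks for the outer derivative at the image of
   0 under the inner map. *)
have ey (k : R) : is_derive ((fun h : R => k * h) 0) (1 : R) (expR : R -> R) 1.
  by apply: is_derive_eq; rewrite mulr0 expR0.
have ec (k : R) : is_derive ((fun h : R => k * h) 0) (1 : R) (cos : R -> R) 0.
  by apply: is_derive_eq; rewrite mulr0 sin0 oppr0.
have es (k : R) : is_derive ((fun h : R => k * h) 0) (1 : R) (sin : R -> R) 1.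
  by apply: is_derive_eq; rewrite mulr0 cos0.
have dr : is_derive (0 : R) (1 : R)
    ((expR \o (fun h => - a * h)) * (cos \o (fun h => - b * h)) : R -> R) (- a).
  apply: is_derive_eq => /=; rewrite !mulr0 expR0 cos0.
  by rewrite !(scale1r, scaler0, add0r, mul1r, mulr0) mul0r add0r.
have di : is_derive (0 : R) (1 : R)
    ((expR \o (fun h => - a * h)) * (sin \o (fun h => - b * h)) : R -> R) (- b).
  apply: is_derive_eq => /=; rewrite !mulr0 expR0 sin0.
  by rewrite !(scale1r, scale0r, scaler0, addr0, add0r, mul1r, mulr1, mulr0) .
split.
  have -> : complex.Re (- (a +i* b)) = - a by [].
  rewrite (_ : (fun n => _) = (fun n => (((expR \o (fun h => - a * h)) *
    (cos \o (fun h => - b * h))) (h n) - ((expR \o (fun h => - a * h)) *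
    (cos \o (fun h => - b * h))) 0) / h n)); first exact: (quo _ _ dr).
  apply/funext => n; rewrite /= !fctE /= !mulr0 expR0 cos0 /cexp /=.
  by rewrite !(mulr0,mulr1,subr0,mul0r,addr0,add0r,mulNr).
have -> : complex.Im (- (a +i* b)) = - b by [].
rewrite (_ : (fun n => _) = (fun n => (((expR \o (fun h => - a * h)) *
  (sin \o (fun h => - b * h))) (h n) - ((expR \o (fun h => - a * h)) *
  (sin \o (fun h => - b * h))) 0) / h n)); first exact: (quo _ _ di).
apply/funext => n; rewrite /= !fctE /= !mulr0 expR0 sin0 /cexp /=.
by rewrite !(mulr0,mulr1,mul1r,subr0,mul0r,addr0,add0r,mulNr,oppr0).
Qed.

End ComplexSequences.

(** * Expectations of bounded complex variables *)

Section ComplexExpectation.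
Variables (R : realType) (d : measure_display) (T : measurableType d).
Variable P : probability T R.
Implicit Types (X : T -> R[i]).

Definition cmeasurable X :=
  measurable_fun setT (fun w => complex.Re (X w)) /\
  measurable_fun setT (fun w => complex.Im (X w)).

Definition cintegrable X :=
  P.-integrable setT (EFin \o (fun w => complex.Re (X w))) /\
  P.-integrable setT (EFin \o (fun w => complex.Im (X w))).

Lemma cmeasurable_cst (a : R[i]) : cmeasurable (fun=> a).
Proof. by split; apply: measurable_cst. Qed.

Lemma cmeasurableD X Y : cmeasurable X -> cmeasurable Y ->
  cmeasurable (fun w => X w + Y w).
Proof.
move=> [xr xi] [yr yi]; split.
  by under eq_fun do rewrite ReD; apply: measurable_funD.
by under eq_fun do rewrite ImD; apply: measurable_funD.
Qed.

Lemma cmeasurableM X Y : cmeasurable X -> cmeasurable Y ->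
  cmeasurable (fun w => X w * Y w).
Proof.
move=> [xr xi] [yr yi]; split.
  under eq_fun do rewrite ReM.
  by apply: measurable_funB; apply: measurable_funM.
under eq_fun do rewrite ImM.
by apply: measurable_funD; apply: measurable_funM.
Qed.

Lemma cmeasurable_sum (I : finType) (X : I -> T -> R[i]) :
  (forall i, cmeasurable (X i)) -> cmeasurable (fun w => \sum_i X i w).
Proof.
move=> mX; elim: (index_enum I) => [|i r IH].
  by under eq_fun do rewrite big_nil; apply: cmeasurable_cst.
by under eq_fun do rewrite big_cons; apply: cmeasurableD.
Qed.

Lemma cmeasurable_indic (E : set T) : measurable E ->
  cmeasurable (fun w => (w \in E)%:R).
Proof.
move=> mE; split.
  rewrite (_ : (fun w => _) = \1_E :> (T -> R)); first exact: measurable_indic.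
  by apply/funext => w; rewrite indicE; case: (_ \in _).
rewrite (_ : (fun w => _) = cst 0); first exact: measurable_cst.
by apply/funext => w; case: (_ \in _).
Qed.

Lemma cmeasurable_cvg (X : nat -> T -> R[i]) (Y : T -> R[i]) :
  (forall n, cmeasurable (X n)) -> (forall w, ccvg (X^~ w) (Y w)) ->
  cmeasurable Y.
Proof.
move=> mX XY; split.
  apply: (@measurable_fun_cvg _ _ _ _ (fun n w => complex.Re (X n w))).
    by move=> n; exact: (mX n).1.
  by move=> w _; exact: (XY w).1.
apply: (@measurable_fun_cvg _ _ _ _ (fun n w => complex.Im (X n w))).
  by move=> n; exact: (mX n).2.
by move=> w _; exact: (XY w).2.
Qed.

Lemma bounded_cintegrable X : cmeasurable X -> (forall w, `|X w| <= 1) ->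
  cintegrable X.
Proof.
move=> [mr mi] X1; split; apply: measurable_bounded_integrable => //;
  rewrite ?(le_lt_trans (probability_le1 P _)) ?ltry //;
  exists 1; split => // M M1 w _ /=; have [r i] := ReIm_le1 (X1 w);
  by rewrite (le_trans _ (ltW M1)).
Qed.

Lemma cexpectation_sum (I : finType) (X : I -> T -> R[i]) :
  (forall i, cintegrable (X i)) ->
  cexpectation P (fun w => \sum_i X i w) = \sum_i cexpectation P (X i).
Proof.
move=> iX; rewrite /cexpectation unlock.
have H (f : I -> T -> R) : (forall i, P.-integrable setT (EFin \o f i)) ->
    fine (\int[P]_w (\sum_i f i w)%:E)%E = \sum_i fine (\int[P]_w (f i w)%:E)%E.
  move=> fi; rewrite (_ : (fun w => _) = (fun w => \sum_i (f i w)%:E)%E); last first.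
    by apply/funext => w; rewrite sumEFin.
  rewrite integral_sum// -sum_fine // => i _.
  exact: (integrable_fin_num _ (fi i)).
apply: ReIm_eq => /=.
  rewrite Re_sum /= -H; last by move=> i; exact: (iX i).1.
  by congr (fine _); apply: eq_integral => w _; rewrite Re_sum.
rewrite Im_sum /= -H; last by move=> i; exact: (iX i).2.
by congr (fine _); apply: eq_integral => w _; rewrite Im_sum.
Qed.

Lemma cexpectationZ (a : R[i]) X : cintegrable X ->
  cexpectation P (fun w => a * X w) = a * cexpectation P X.
Proof.
move=> [xr xi]; rewrite /cexpectation unlock.
have H (k l : R) (f g : T -> R) : P.-integrable setT (EFin \o f) ->
   P.-integrable setT (EFin \o g) ->
   fine (\int[P]_w (k * f w + l * g w)%:E)%E =
   k * fine (\int[P]_w (f w)%:E)%E + l * fine (\int[P]_w (g w)%:E)%E.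
  move=> fi gi.
  have := @RintegralD _ _ _ P setT (fun w => k * f w) (fun w => l * g w).
  rewrite /Rintegral => ->//.
  - by have := @RintegralZl _ _ _ P setT f k; rewrite /Rintegral => ->//;
     have := @RintegralZl _ _ _ P setT g l; rewrite /Rintegral => ->//.
  - by have := integrableZl measurableT k fi.
  - by have := integrableZl measurableT l gi.
apply: ReIm_eq => /=; rewrite ?ReM ?ImM /= -?mulNr -H//.
  by congr (fine _); apply: eq_integral => w _; rewrite ReM mulNr.
by congr (fine _); apply: eq_integral => w _; rewrite ImM.
Qed.

Lemma cexpectation_indic (E : set T) : measurable E ->
  cexpectation P (fun w => (w \in E)%:R) = (fine (P E))%:C.
Proof.
move=> mE; rewrite /cexpectation; apply: ReIm_eq => /=.
  rewrite -(expectation_indic P mE); congr (fine ('E_P[_])%E).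
  by apply/funext => w; rewrite indicE; case: (_ \in _).
rewrite (_ : (fun w => _) = cst 0) ?expectation_cst//.
by apply/funext => w; case: (_ \in _).
Qed.

(** Dominated convergence with majorant 1, which is integrable for a probability. Measurability of
    the limit is a consequence, so it never has to be checked for the hitting functional itself. *)
Lemma cexpectation_cvg (X : nat -> T -> R[i]) (Y : T -> R[i]) :
  (forall n, cmeasurable (X n)) -> (forall n w, `|X n w| <= 1) ->
  (forall w, ccvg (X^~ w) (Y w)) ->
  ccvg (fun n => cexpectation P (X n)) (cexpectation P Y).
Proof.
move=> mX X1 XY; have mY := cmeasurable_cvg mX XY.
have H (f : nat -> T -> R) (g : T -> R) : (forall n, measurable_fun setT (f n)) ->
    measurable_fun setT g -> (forall n w, `|f n w| <= 1) ->
    (forall w, f n w @[n --> \oo] --> g w) ->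
    fine (\int[P]_w (f n w)%:E)%E @[n --> \oo] --> fine (\int[P]_w (g w)%:E)%E.
  move=> mf mg f1 fg.
  have i1 : P.-integrable setT (cst 1%:E : T -> \bar R).
    apply: (@measurable_bounded_integrable _ _ _ P (cst 1)) => //.
      by rewrite (le_lt_trans (probability_le1 P _)) ?ltry.
    by exists 1; split => // M M1 w _ /=; rewrite normr1 ltW.
  have [||||ig _ cv] := @dominated_convergence _ _ _ P setT measurableT
    (fun n w => (f n w)%:E) (fun w => (g w)%:E) (cst 1%:E) _ _ _ i1 _.
  - by move=> n; exact/measurable_EFinP.
  - exact/measurable_EFinP.
  - by apply: aeW => w _; apply: cvg_EFin; [near=> n|exact: fg].
  - by apply: aeW => w n _; rewrite /= lee_fin.
  apply: fine_cvg; rewrite fineK//.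
  exact: integrable_fin_num.
rewrite /cexpectation unlock; split => /=; apply: H.
- by move=> n; exact: (mX n).1.
- exact: mY.1.
- by move=> n w; have [] := ReIm_le1 (X1 n w).
- by move=> w; exact: (XY w).1.
- by move=> n; exact: (mX n).2.
- exact: mY.2.
- by move=> n w; have [] := ReIm_le1 (X1 n w).
- by move=> w; exact: (XY w).2.
Unshelve. all: by end_near.
Qed.

End ComplexExpectation.

(** * Sampling a path on a grid *)

Section DiscreteFunctional.
Variables (R : realType) (S : Type).
Variables (B : pred S) (g : S -> R) (s : R[i]) (v : S -> R[i]).
Hypotheses (s_ge0 : 0 <= complex.Re s) (g_ge0 : forall x, 0 <= g x).
Hypothesis (v_le1 : forall x, `|v x| <= 1).

(* [zeta l] is the state at time [(l+1) h]; the path is followed for [k] steps,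
   pays [h * g] at each point before the first one in [B], and contributes [v]
   there, or 0 if [B] is not reached. *)
Fixpoint grid_lst (h : R) (k : nat) (zeta : nat -> S) : R[i] :=
  if k is k'.+1 then
    if B (zeta 0%N) then v (zeta 0%N)
    else cexp (- (s * (h * g (zeta 0%N))%:C)) * grid_lst h k' (zeta \o succn)
  else 0.

Lemma grid_lst_none h k zeta : (forall l, (l < k)%N -> ~~ B (zeta l)) ->
  grid_lst h k zeta = 0.
Proof.
elim: k zeta => //= k IH zeta Bz.
by rewrite (negbTE (Bz _ _)) // IH ?mulr0 // => l lk; apply: Bz.
Qed.

Lemma grid_lst_first h k j zeta : (j < k)%N ->
  (forall l, (l < j)%N -> ~~ B (zeta l)) -> B (zeta j) ->
  grid_lst h k zeta =
  cexp (- (s * (h * \sum_(l < j) g (zeta l))%:C)) * v (zeta j).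
Proof.
elim: j k zeta => [|j IH] [//|k] zeta jk Bz Bj /=.
  by rewrite Bj big_ord0 mulr0 mulr0 oppr0 cexp0 mul1r.
rewrite (negbTE (Bz _ _)) // (IH k) //; last by move=> l lj; apply: Bz.
by rewrite mulrA -cexpD big_ord_recl -opprD -mulrDr -rmorphD -mulrDr.
Qed.

(** Here the sign of Re s enters: nonnegative costs can only shrink the modulus. *)
Lemma norm_cost_weight h x : 0 <= h -> `|cexp (- (s * (h * g x)%:C))| <= 1.
Proof.
move=> h0; rewrite norm_cexp (_ : 1 = 1%:C) // lecR -expR0 ler_expR.
case: s s_ge0 => a b /= a0; rewrite mulr0 subr0 oppr_le0.
by rewrite !mulr_ge0.
Qed.

Lemma grid_lst_norm h k zeta : 0 <= h -> `|grid_lst h k zeta| <= 1.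
Proof.
move=> h0; elim: k zeta => [|k IH] zeta /=; first by rewrite normr0.
by case: ifP => _ //; rewrite normrM mulr_ile1 // norm_cost_weight.
Qed.

(** In [k] the truncated functionals are stationary from one past the index of the first sample in
    [B], so the limit is written as the value there; a path avoiding [B] gives 0. *)
Definition grid_lst_lim h zeta : R[i] :=
  grid_lst h (if pselect (exists j, B (zeta j)) is left e then (ex_minn e).+1
              else 0%N) zeta.

Lemma grid_lst_limE h zeta j :
  (forall l, (l < j)%N -> ~~ B (zeta l)) -> B (zeta j) ->
  grid_lst_lim h zeta =
  cexp (- (s * (h * \sum_(l < j) g (zeta l))%:C)) * v (zeta j).
Proof.
move=> Bz Bj; rewrite /grid_lst_lim; case: pselect => [e|[]]; last by exists j.
case: ex_minnP => i Bi mi; have -> : i = j.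
  apply/eqP; rewrite eqn_leq mi //= leqNgt; apply/negP => /Bz.
  by rewrite Bi.
exact: grid_lst_first.
Qed.

Lemma grid_lst_lim_none h zeta : (forall l, ~~ B (zeta l)) ->
  grid_lst_lim h zeta = 0.
Proof. by move=> Bz; apply: grid_lst_none. Qed.

Lemma grid_lst_cvg h zeta :
  ccvg (fun k => grid_lst h k zeta) (grid_lst_lim h zeta).
Proof.
apply: near_ccvg (ccvg_cst _); rewrite /grid_lst_lim.
case: pselect => [e|e].
  case: ex_minnP => i Bi mi; exists i.+1 => // k ik.
  have Bz l : (l < i)%N -> ~~ B (zeta l).
    by move=> li; apply/negP => /mi; rewrite leqNgt li.
  by rewrite !(@grid_lst_first _ _ i) ?ltnSn.
exists 0%N => // k _; rewrite !grid_lst_none // => l _.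
by apply/negP => Bl; apply: e; exists l.
Qed.

End DiscreteFunctional.

(** * Grid times and paths that are stationary to the right *)

Section Grid.
Variable R : realType.
Implicit Types (t h : R).

Lemma grid_exists t h : 0 < h -> exists l : nat, t <= l.+1%:R * h.
Proof.
move=> h0; exists (Num.bound (t / h)); rewrite -ler_pdivrMr //.
have [t0|/ltW t0] := leP 0 (t / h); last by rewrite (le_trans t0).
rewrite (le_trans (ltW (archi_boundP t0))) // ler_nat; exact: leqnSn.
Qed.

Definition right_stationary (S : Type) (z : R -> S) :=
  forall t, 0 <= t -> \forall u \near t^'+, z u = z t.

Lemma right_stationaryP (S : Type) (z : R -> S) t : right_stationary z -> 0 <= t ->
  exists2 e, 0 < e & forall u, t <= u -> u < t + e -> z u = z t.
Proof.
move=> rz t0; have := rz t t0; rewrite near_withinE => /nbhs_ballP[e /= e0 H].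
exists e => // u tu ue; have [->//|tu'] := eqVneq t u.
apply: H; last by rewrite lt_neqAle tu'.
by rewrite /ball /= ltr_distlC; apply/andP; split; lra.
Qed.

Definition mesh (n : nat) : R := n.+1%:R^-1.

Lemma mesh_gt0 n : 0 < mesh n. Proof. by rewrite invr_gt0. Qed.

Lemma mesh_cvg : mesh n @[n --> \oo] --> 0.
Proof. exact: cvg_harmonic. Qed.

Lemma mesh_lt e : 0 < e -> \forall n \near \oo, mesh n < e.
Proof.
move=> e0; have /cvgrPdist_lt/(_ e e0) := mesh_cvg.
by apply: filterS => n; rewrite sub0r normrN gtr0_norm ?mesh_gt0.
Qed.

(** The sample of index [l] is taken at time [l.+1 * mesh n], so this is the index of the first
    sample at or after [t]. Time 0 is never sampled, in accordance with the infimum over [0 < t] in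
    the hitting time. *)
Definition gindex t n : nat := ex_minn (grid_exists t (mesh_gt0 n)).

Lemma gindexP t n : [/\ t <= (gindex t n).+1%:R * mesh n,
  forall l, (l < gindex t n)%N -> l.+1%:R * mesh n < t &
  0 <= t -> (gindex t n).+1%:R * mesh n <= t + mesh n].
Proof.
rewrite /gindex; case: ex_minnP => l tl ml.
have H l' : (l' < l)%N -> l'.+1%:R * mesh n < t.
  by move=> l'l; rewrite ltNge; apply/negP => /ml; rewrite leqNgt l'l.
split => // t0; case: l tl ml H => [|l] _ _ H; first by rewrite mul1r lerDr.
by rewrite -natr1 mulrDl mul1r lerD2r ltW // H.
Qed.

Lemma right_stationary_grid (S : Type) (z : R -> S) t : right_stationary z ->
  0 <= t -> \forall n \near \oo, z ((gindex t n).+1%:R * mesh n) = z t.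
Proof.
move=> rz t0; have [e e0 H] := right_stationaryP rz t0.
have := mesh_lt e0; apply: filterS => n ne.
by have [t1 _ /(_ t0) t2] := gindexP t n; apply: H => //; lra.
Qed.

End Grid.

(** * Limit of the sampled functionals along a path *)

Section RiemannSums.
Variables (R : realType) (f : R -> R) (M t : R).
Hypotheses (f_ge0 : forall u, 0 <= f u) (f_leM : forall u, f u <= M).
Hypothesis f_rs : right_stationary f.

Local Notation h n := (mesh R n).
Local Notation cell n l := (`]l%:R * h n, l.+1%:R * h n]%classic : set R).

(** Each cell carries the value at its right end. Only cells ending before [t] are kept, since the
    discrete cost stops before the first sample in [B]. *)
Let step (n : nat) (u : R) : R :=
  \sum_(l < gindex t n) f (l.+1%:R * h n) * \1_(cell n l) u.

Local Lemma step_at n l u : (l < gindex t n)%N -> l%:R * h n < u ->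
  u <= l.+1%:R * h n -> step n u = f (l.+1%:R * h n).
Proof.
move=> lg lu ul; rewrite /step (bigD1 (Ordinal lg)) //= big1 => [|i il].
  by rewrite addr0 indicE mem_set ?mulr1 //= in_itv /= lu.
rewrite indicE memNset ?mulr0 //= in_itv /= => /andP[iu ui].
have lt_nat (a b : nat) : a%:R * h n < b%:R * h n -> (a < b)%N.
  by rewrite ltr_pM2r ?mesh_gt0 // ltr_nat.
case/negP: il; apply/eqP/val_inj => /=; apply/eqP; rewrite eqn_leq.
by apply/andP; split; rewrite -ltnS; apply: lt_nat;
  [exact: lt_le_trans iu ul|exact: lt_le_trans lu ui].
Qed.

Local Lemma step_bound n u : `|step n u| <= M.
Proof.
have M0 : 0 <= M := le_trans (f_ge0 0) (f_leM 0).
have [[l lg /andP[lu ul]]|nl] := pselect (exists2 l : nat,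
    (l < gindex t n)%N & (l%:R * h n < u) && (u <= l.+1%:R * h n)).
  by rewrite (step_at lg lu ul) ger0_norm.
rewrite /step big1 ?normr0 // => i _; rewrite indicE memNset ?mulr0 //=.
by rewrite in_itv /= => iu; apply: nl; exists i.
Qed.

Local Lemma step_cvg u : 0 < u < t -> step n u @[n --> \oo] --> f u.
Proof.
move=> /andP[u0 ut]; have [e e0 H] := right_stationaryP f_rs (ltW u0).
(* A mesh below [e] gives the right end of the cell of [u] the same value as [u]; a mesh below
   [t - u] makes that cell end before [t], so it is not among those left out. *)
have m0 : 0 < Num.min e (t - u) by rewrite lt_min e0 subr_gt0.
apply: (@cvg_trans _ (f u @[n --> \oo])); last exact: cvg_cst.
apply: near_eq_cvg; have := mesh_lt m0; apply: filterS => n.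
rewrite lt_min => /andP[ne nt].
have [u1 lu /(_ (ltW u0)) u2] := gindexP u n.
set l := gindex u n in u1 lu u2.
rewrite (@step_at n l) //.
- by rewrite H //; lra.
- have [t1 _ _] := gindexP t n; rewrite ltnNge; apply/negP => gl.
  have : (gindex t n).+1%:R * h n <= l.+1%:R * h n.
    by rewrite ler_pM2r ?mesh_gt0 // ler_nat.
  by lra.
- case: l lu {u1 u2} => [|l] lu; first by rewrite mul0r.
  exact: lu.
Qed.

Local Lemma step_measurable n : measurable_fun setT (step n).
Proof.
apply: measurable_sum => l; apply: measurable_funM; first exact: measurable_cst.
by apply: measurable_indic.
Qed.

Local Lemma step_integral n :
  \int[lebesgue_measure]_(u in `]0, t[) step n u =
  h n * \sum_(l < gindex t n) f (l.+1%:R * h n).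
Proof.
rewrite /step /Rintegral.
under eq_integral do rewrite -sumEFin.
rewrite ge0_integral_sum //; last 2 first.
- move=> l; apply/measurable_EFinP/measurable_funM; first exact: measurable_cst.
  by apply: measurable_indic.
- by move=> l u _; rewrite lee_fin mulr_ge0.
rewrite mulr_sumr -[RHS]/(fine _%:E) -sumEFin; congr (fine _).
apply: eq_bigr => l _.
under eq_integral do rewrite EFinM.
rewrite ge0_integralZl ?lee_fin //; last first.
  by apply/measurable_EFinP; apply: measurable_indic.
rewrite integral_indic //.
have [_ /(_ l (ltn_ord l)) lt _] := gindexP t n.
rewrite setIidl; last first.
  move=> u; rewrite /= !in_itv /= => /andP[lu ul].
  rewrite (le_lt_trans ul lt) andbT (le_lt_trans _ lu) //.
  by rewrite mulr_ge0 // ltW // mesh_gt0.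
have muE : lebesgue_measure (cell n l) = (h n)%:E :> \bar R.
  rewrite lebesgue_measure_itv /= lte_fin ltr_pM2r ?mesh_gt0 // ltr_nat ltnSn.
  by rewrite -EFinB -mulrBl -natrB // subSnn mul1r.
by rewrite [X in _ = X%:E]mulrC EFinM; congr (_ * _)%E; exact: muE.
Qed.

(** The right end of the cell containing [u] tends to [u] from the right, where [f] is locally
    constant, so the step functions converge at every interior point. The same convergence yields
    measurability of [f], and the bound [M] on a bounded interval gives domination. *)
Lemma right_riemann_sum_cvg :
  h n * (\sum_(l < gindex t n) f (l.+1%:R * h n)) @[n --> \oo] -->
  \int[lebesgue_measure]_(u in `[0, t]) f u.
Proof.
have mD : measurable (`]0, t[ : set (measurableTypeR R)) by [].
have Dfin : (lebesgue_measure (`]0%R, t[ : set (measurableTypeR R)) < +oo)%E.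
  by rewrite lebesgue_measure_itv; case: ifP => _ //; rewrite -EFinB ltry.
have sc u : `]0, t[%classic u -> step n u @[n --> \oo] --> f u.
  by rewrite /= in_itv => ?; exact: step_cvg.
have mf : measurable_fun (`]0, t[ : set (measurableTypeR R)) f.
  apply: (@measurable_fun_cvg _ _ _ _ step) => // n.
  by apply: measurable_funTS; exact: step_measurable.
have M0 : 0 <= M := le_trans (f_ge0 0) (f_leM 0).
have fi : lebesgue_measure.-integrable `]0, t[ (EFin \o f).
  apply: measurable_bounded_integrable => //.
  exists M; split; [exact: num_real|] => m Mm u _ /=; rewrite ger0_norm //.
  by rewrite (le_trans (f_leM u)) // ltW.
(* Convergence is known strictly between 0 and [t] only; the two endpoints form a null set. *)
rewrite {1}/Rintegral integral_itv_bndoo; last exact/measurable_EFinP.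
under eq_fun do rewrite -step_integral.
apply: fine_cvg; rewrite fineK; last exact: integrable_fin_num.
apply: (@dominated_cvg _ _ _ lebesgue_measure _ mD (fun n u => (step n u)%:E)
  (EFin \o f) (cst M%:E)) => //.
- by move=> n; apply/measurable_EFinP; apply: measurable_funTS; exact: step_measurable.
- by move=> u Du; apply: cvg_EFin; [near=> n|exact: sc].
- apply: (@measurable_bounded_integrable _ _ _ _ (cst M)) => //.
  by exists M; split; [exact: num_real|] => m Mm u _ /=; rewrite ger0_norm // ltW.
- by move=> n u _; rewrite /= lee_fin step_bound.
Unshelve. all: by end_near.
Qed.

End RiemannSums.

(** * The sampled functional at the first hitting time *)

Section PathLimit.
Variables (R : realType) (S : Type) (z : R -> S).
Variables (B : pred S) (g : S -> R) (M : R) (s : R[i]) (v : S -> R[i]).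
Hypotheses (g_ge0 : forall x, 0 <= g x) (g_leM : forall x, g x <= M).
Hypothesis z_rs : right_stationary z.

Let tau : \bar R := ereal_inf [set t%:E | t in [set t : R | 0 < t /\ B (z t)]].

(** Visits to [B] occur arbitrarily soon at or after [tau], where the path still has its value at
    [tau]; hence that value lies in [B]. This also covers [tau = 0]. *)
Lemma first_hitP : (tau < +oo)%E -> exists t : R,
  [/\ tau = t%:E, 0 <= t, B (z t) & forall u, 0 < u -> u < t -> ~~ B (z u)].
Proof.
move=> tfin; have t0 : (0 <= tau)%E.
  by apply: le_ereal_inf_tmp => _ [u [u0 _] <-]; rewrite lee_fin ltW.
have tf : tau \is a fin_num by rewrite ge0_fin_numE.
exists (fine tau); have tE : tau = (fine tau)%:E by rewrite fineK.
have ft0 : 0 <= fine tau by rewrite fine_ge0.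
split => //.
- have [e e0 H] := right_stationaryP z_rs ft0.
  have : (tau < (fine tau + e)%:E)%E by rewrite [X in (X < _)%E]tE lte_fin ltrDl.
  move=> /ereal_inf_lt [_ [u [u0 Bu] <-]]; rewrite lte_fin => ut.
  rewrite -(H u) // -lee_fin -tE.
  by apply: ereal_inf_lbound; exists u.
- move=> u u0 ut; apply/negP => Bu.
  have : (tau <= u%:E)%E by apply: ereal_inf_lbound; exists u.
  by rewrite tE lee_fin leNgt ut.
Qed.

(** For a fine mesh the first sample in [B] is the one of index [gindex t n]: samples before [t]
    avoid [B], and the next one still shows the state [z t]. If [tau] is infinite, no sample lies in
    [B], because all sampling times are positive. *)
Lemma grid_lst_lim_cvg :
  ccvg (fun n => grid_lst_lim B g s v (mesh R n) (fun l => z (l.+1%:R * mesh R n)))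
    (if (tau < +oo)%E then
       let t := fine tau in
       cexp (- (s * (\int[lebesgue_measure]_(u in `[0, t]) g (z u))%:C)) * v (z t)
     else 0).
Proof.
case: ifP => [/first_hitP[t [-> t0 Bt tB]]|/negbT]; last first.
  rewrite -leNgt leye_eq => /eqP toy; apply: near_ccvg (ccvg_cst _).
  exists 0%N => // n _; rewrite grid_lst_lim_none // => l.
  apply/negP => Bl; have : (tau <= (l.+1%:R * mesh R n)%:E)%E.
    by apply: ereal_inf_lbound; exists (l.+1%:R * mesh R n) => //; split => //;
      rewrite mulr_gt0 // mesh_gt0.
  by rewrite toy leye_eq.
rewrite /=; set f := fun u => g (z u).
have f_rs : right_stationary f.
  by move=> u u0; have := z_rs u0; apply: filterS => w; rewrite /f => ->.
have ic := @right_riemann_sum_cvg R f M t (fun u => g_ge0 _) (fun u => g_leM _) f_rs.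
apply: near_ccvg (ccvgM (ccvg_cexp s ic) (ccvg_cst (v (z t)))).
have := right_stationary_grid z_rs t0; apply: filterS => n zn.
have [t1 t2 _] := gindexP t n.
rewrite (@grid_lst_limE _ _ _ _ _ _ _ _ (gindex t n)).
- by rewrite zn.
- by move=> l lg; apply: tB; [rewrite mulr_gt0 // mesh_gt0|exact: t2].
- by rewrite zn.
Qed.

End PathLimit.

(** * The harmonic equation *)

Section FirstStep.
Variables (R : realType) (S : finType) (d : measure_display).
Variables (T : measurableType d) (P : S -> probability T R) (Z : R -> T -> S).
Variables (Pt : R -> S -> S -> R).
Hypothesis Z_meas : forall t x, 0 <= t -> measurable [set w | Z t w = x].
Hypothesis Z_start : forall x, P x [set w | Z 0 w = x] = 1%E.
Hypothesis Z_markov :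
  forall (x0 : S) (r : nat) (t : nat -> R) (x : nat -> S) (u : R) (y : S),
    0 <= t 0%N -> (forall l, t l < t l.+1) -> 0 <= u ->
    P x0 [set w | (forall l, (l <= r)%N -> Z (t l) w = x l) /\
                  Z (t r + u) w = y] =
    (P x0 [set w | forall l, (l <= r)%N -> Z (t l) w = x l] *
       (Pt u (x r) y)%:E)%E.
Variables (B : pred S) (g : S -> R) (s : R[i]) (v : S -> R[i]).
Hypotheses (s_ge0 : 0 <= complex.Re s) (g_ge0 : forall x, 0 <= g x).
Hypothesis (v_le1 : forall x, `|v x| <= 1).

Lemma grid_lst_measurable h k (zeta : nat -> T -> S) :
  (forall l x, measurable [set w | zeta l w = x]) ->
  cmeasurable (fun w => grid_lst B g s v h k (zeta^~ w)).
Proof.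
elim: k zeta => [|k IH] zeta mz /=; first exact: cmeasurable_cst.
rewrite (_ : (fun w => _) = fun w => \sum_x (w \in [set w | zeta 0%N w = x])%:R *
  (if B x then v x else cexp (- (s * (h * g x)%:C)) *
    grid_lst B g s v h k (fun l => zeta l.+1 w))); last first.
  apply/funext => w; rewrite (bigD1 (zeta 0%N w)) //= mem_set // mul1r.
  rewrite big1 ?addr0 // => x /eqP xz; rewrite memNset ?mul0r //.
  by move=> /= zx; apply: xz.
apply: cmeasurable_sum => x; apply: cmeasurableM.
  exact: cmeasurable_indic.
case: (B x); first exact: cmeasurable_cst.
apply: cmeasurableM; first exact: cmeasurable_cst.
by apply: (IH (fun l => zeta l.+1)) => l y; apply: mz.
Qed.

(** Backward recursion with kernel [Pt h], free of any probability space. Expectations under the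
    different laws [P x] are compared through it. *)
Fixpoint step_lst (h : R) (k : nat) (x : S) : R[i] :=
  if k is k'.+1 then
    \sum_y (Pt h x y)%:C * (if B y then v y
                            else cexp (- (s * (h * g y)%:C)) * step_lst h k' y)
  else 0.

(** * The Markov property at multiples of a fixed mesh *)

Section FixedMesh.
Variable h : R.
Hypothesis h_gt0 : 0 < h.

Let past r (x : nat -> S) : set T :=
  [set w | forall l, (l <= r)%N -> Z (l%:R * h) w = x l].
Let future r w (l : nat) : S := Z ((r + l).+1%:R * h) w.

Local Lemma time_ge0 l : 0 <= l%:R * h :> R.
Proof. by rewrite mulr_ge0 // ltW. Qed.

Local Lemma past_measurable r x : measurable (past r x).
Proof.
rewrite (_ : past r x = \bigcap_(l in `I_r.+1) [set w | Z (l%:R * h) w = x l]).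
  apply: bigcap_measurable; first by exists 0%N.
  by move=> l _; apply: Z_meas; exact: time_ge0.
by apply/seteqP; split => w /= H l lr; apply: H.
Qed.

Let upd r (x : nat -> S) (z : S) l := if l == r.+1 then z else x l.

Local Lemma past_upd r x z :
  past r.+1 (upd r x z) = past r x `&` [set w | Z (r.+1%:R * h) w = z].
Proof.
apply/seteqP; split => w /=.
  move=> H; split; last by rewrite H // /upd eqxx.
  by move=> l lr; rewrite H ?(leqW lr) // /upd ltn_eqF.
move=> [H Hz] l; rewrite leq_eqVlt /upd; case: eqP => [->//|_ /=].
by rewrite ltnS; exact: H.
Qed.

Local Lemma past_upd_prob x0 r x z : fine (P x0 (past r.+1 (upd r x z))) =
  fine (P x0 (past r x)) * Pt h (x r) z.
Proof.
have := @Z_markov x0 r (fun l => l%:R * h) x h z.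
rewrite mul0r lexx ltW // => /(_ isT) H.
rewrite -[RHS]/(_ * fine (Pt h (x r) z)%:E) -fineM //; last first.
  by apply: fin_num_measure; exact: past_measurable.
rewrite -H //; last by move=> l; rewrite ltr_pM2r // ltr_nat.
congr (fine (P x0 _)); rewrite past_upd; apply/seteqP.
by split => w /= [H1 H2]; split => //; move: H2; rewrite -natr1 mulrDl mul1r.
Qed.

Local Lemma future_measurable r k :
  cmeasurable (fun w => grid_lst B g s v h k (future r w)).
Proof.
by apply: (@grid_lst_measurable _ _ (fun l w => future r w l)) => l x;
  apply: Z_meas; exact: time_ge0.
Qed.

Local Lemma weighted_cintegrable x0 r x (Y : T -> R[i]) : cmeasurable Y ->
  (forall w, `|Y w| <= 1) -> cintegrable (P x0) (fun w => (w \in past r x)%:R * Y w).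
Proof.
move=> mY Y1; apply: bounded_cintegrable.
  by apply: cmeasurableM => //; apply: cmeasurable_indic; exact: past_measurable.
by move=> w; case: (_ \in _); rewrite ?mul1r ?mul0r ?normr0.
Qed.

(** The whole sampled past is kept as a weight because the Markov hypothesis concerns such events
    under the fixed law [P x0]. Each step of the induction on [k] moves one sample from the future
    into the past, which multiplies the weight by one value of [Pt h]. *)
Local Lemma cexpectation_past x0 r x k :
  cexpectation (P x0)
    (fun w => (w \in past r x)%:R * grid_lst B g s v h k (future r w)) =
  (fine (P x0 (past r x)))%:C * step_lst h k (x r).
Proof.
elim: k r x => [|k IH] r x.
  rewrite /= mulr0 (_ : (fun w => _) = (fun w => 0 * (w \in past r x)%:R)).
    rewrite cexpectationZ ?mul0r //; apply: bounded_cintegrable.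
      by apply: cmeasurable_indic; exact: past_measurable.
    by move=> w; case: (_ \in _); rewrite ?normr1 ?normr0.
  by apply/funext => w; rewrite mulr0 mul0r.
(* The factor [e z] is what the step to [z] contributes, and [F z] is what remains to be averaged;
   it is 1 after absorption in [B]. *)
pose e z : R[i] := if B z then v z else cexp (- (s * (h * g z)%:C)).
pose F z w : R[i] := if B z then 1 else grid_lst B g s v h k (future r.+1 w).
have Fint z : cintegrable (P x0) (fun w => (w \in past r.+1 (upd r x z))%:R * F z w).
  rewrite /F; apply: weighted_cintegrable.
    by case: (B z); [exact: cmeasurable_cst|exact: future_measurable].
  by move=> w; case: ifP => _; rewrite ?normr1 // grid_lst_norm // ltW.
transitivity (cexpectation (P x0) (fun w => \sum_z
    e z * ((w \in past r.+1 (upd r x z))%:R * F z w))).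
  congr (cexpectation _ _); apply/funext => w.
  have [wp|wp] := boolP (w \in past r x); last first.
    rewrite mul0r big1 // => z _; rewrite memNset ?mul0r ?mulr0 // past_upd.
    by move=> [/mem_set]; rewrite (negbTE wp).
  have wz z : Z (r.+1%:R * h) w != z -> w \notin past r.+1 (upd r x z).
    by move=> /eqP zn; rewrite notin_setE past_upd => -[].
  rewrite mul1r (bigD1 (future r w 0%N)) //= big1 => [|z zn].
    rewrite addr0 mem_set; last first.
      by rewrite past_upd /future addn0; split => //=; exact: set_mem.
    rewrite mul1r /e /F; case: ifP => _; rewrite ?mulr1 //.
    congr (_ * grid_lst _ _ _ _ _ _ _); apply/funext => l.
    by rewrite /future /= addnS addSn.
  rewrite (negbTE (wz _ _)) ?mul0r ?mulr0 // eq_sym.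
  by move: zn; rewrite /future addn0.
rewrite cexpectation_sum; last first.
  move=> z; apply: bounded_cintegrable.
    apply: cmeasurableM; first exact: cmeasurable_cst.
    apply: cmeasurableM; first by apply: cmeasurable_indic; exact: past_measurable.
    by rewrite /F; case: (B z); [exact: cmeasurable_cst|exact: future_measurable].
  move=> w; rewrite normrM mulr_ile1 //.
    by rewrite /e; case: (B z) => //; apply: norm_cost_weight => //; exact: ltW.
  rewrite normrM mulr_ile1 //; first by case: (_ \in _); rewrite ?normr1 ?normr0.
  by rewrite /F; case: (B z); rewrite ?normr1 // grid_lst_norm // ltW.
rewrite /= mulr_sumr; apply: eq_bigr => z _.
rewrite cexpectationZ //.
transitivity (e z * ((fine (P x0 (past r.+1 (upd r x z))))%:C *
    (if B z then 1 else step_lst h k z))).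
  congr (_ * _); rewrite /F; case: (B z).
    rewrite mulr1 -cexpectation_indic; last exact: past_measurable.
    by congr (cexpectation _ _); apply/funext => w; rewrite mulr1.
  by rewrite IH /upd eqxx.
rewrite past_upd_prob rmorphM /= /e; case: ifP => _; ring.
Qed.

Lemma cexpectation_grid x0 k :
  cexpectation (P x0) (fun w => grid_lst B g s v h k (fun l => Z (l.+1%:R * h) w)) =
  step_lst h k x0.
Proof.
have Fm : cmeasurable (fun w => grid_lst B g s v h k (future 0 w)).
  exact: future_measurable.
have F1 w : `|grid_lst B g s v h k (future 0 w)| <= 1 by rewrite grid_lst_norm // ltW.
have pastE z : past 0 (fun=> z) = [set w | Z 0 w = z].
  apply/seteqP; split => w /=; first by move=> /(_ 0%N isT); rewrite mul0r.
  by move=> H l; rewrite leqn0 => /eqP ->; rewrite mul0r.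
transitivity (cexpectation (P x0) (fun w => \sum_z
    (w \in past 0 (fun=> z))%:R * grid_lst B g s v h k (future 0 w))).
  congr (cexpectation _ _); apply/funext => w; rewrite -mulr_suml.
  rewrite (bigD1 (Z 0 w)) //= pastE mem_set // big1 ?addr0 ?mul1r // => z zn.
  by rewrite pastE memNset //= => zE; move: zn; rewrite zE eqxx.
rewrite cexpectation_sum; last by move=> z; apply: weighted_cintegrable.
rewrite (bigD1 x0) //= big1 => [|z zx].
  by rewrite cexpectation_past pastE Z_start mul1r addr0.
rewrite cexpectation_past pastE; suff -> : P x0 [set w | Z 0 w = z] = 0%E by rewrite mul0r.
have m0 y : measurable [set w | Z 0 w = y] by exact: Z_meas.
apply/eqP; rewrite eq_le measure_ge0 andbT.
have <- : P x0 (~` [set w | Z 0 w = x0]) = 0%E.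
  by rewrite probability_setC // Z_start subee.
apply: le_measure; rewrite ?inE //; first exact: measurableC.
by move=> w /= -> zE; move: zx; rewrite zE eqxx.
Qed.

(** Both sides are limits of [step_lst], taken at [k.+1] on the left and at [k] on the right, so no
    path under [P x] is ever compared with one under [P y]. *)
Lemma grid_lst_lim_first_step x :
  let A y := cexpectation (P y)
    (fun w => grid_lst_lim B g s v h (fun l => Z (l.+1%:R * h) w)) in
  A x = \sum_y (Pt h x y)%:C *
          (if B y then v y else cexp (- (s * (h * g y)%:C)) * A y).
Proof.
move=> A; have cA y : ccvg (fun k => step_lst h k y) (A y).
  under eq_fun do rewrite -cexpectation_grid.
  apply: cexpectation_cvg => [k|k w|w].
  - by apply: (@grid_lst_measurable _ _ (fun l w => Z (l.+1%:R * h) w)) => l z;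
      apply: Z_meas; exact: time_ge0.
  - by rewrite grid_lst_norm // ltW.
  - exact: grid_lst_cvg.
have cS : ccvg (fun k => step_lst h k.+1 x) (A x).
  have [ar ai] := cA x; split.
    by rewrite -(cvg_shiftS (fun k => complex.Re (step_lst h k x))) in ar.
  by rewrite -(cvg_shiftS (fun k => complex.Im (step_lst h k x))) in ai.
apply: (ccvg_unique cS) => /=; apply: ccvg_sum => y; apply: ccvgM.
  exact: ccvg_cst.
case: ifP => _; first exact: ccvg_cst.
by apply: ccvgM; [exact: ccvg_cst|exact: cA].
Qed.

End FixedMesh.

(** * From the one-step equation to the generator *)

Section VanishingMesh.
Variables (Q : S -> S -> R) (M : R).
Hypothesis Pt_Q : forall x y, (Pt h x y - (x == y)%:R) / h @[h --> (0 : R)^'+] --> Q x y.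
Hypothesis Z_rs : forall w, right_stationary (Z^~ w).
Hypothesis g_leM : forall x, g x <= M.

Let hit w : \bar R := ereal_inf [set t%:E | t in [set t : R | 0 < t /\ B (Z t w)]].

Definition hit_lst x : R[i] := cexpectation (P x) (fun w =>
  if (hit w < +oo)%E then
    let t := fine (hit w) in
    cexp (- (s * (\int[lebesgue_measure]_(u in `[0, t]) g (Z u w))%:C)) * v (Z t w)
  else 0).

Lemma hit_lst_harmonic x : ~~ B x ->
  \sum_y ((Q x y)%:C - (x == y)%:R * (s * (g x)%:C)) *
    (if B y then v y else hit_lst y) = 0.
Proof.
move=> Bx; pose A n y := cexpectation (P y)
    (fun w => grid_lst_lim B g s v (mesh R n) (fun l => Z (l.+1%:R * mesh R n) w)).
have cA y : ccvg (A^~ y) (hit_lst y).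
  apply: cexpectation_cvg => [n|n w|w].
  - apply: (@cmeasurable_cvg _ _ _ (fun k w => grid_lst B g s v (mesh R n) k
      (fun l => Z (l.+1%:R * mesh R n) w))) => [k|w]; last exact: grid_lst_cvg.
    by apply: (@grid_lst_measurable _ _ (fun l w => Z (l.+1%:R * mesh R n) w)) => l z;
      apply: Z_meas; apply: time_ge0; exact: mesh_gt0.
  - by rewrite grid_lst_norm // ltW // mesh_gt0.
  - by apply: (@grid_lst_lim_cvg _ _ (Z^~ w) B g M).
pose e n y : R[i] := if B y then 1 else cexp (- (s * (mesh R n * g y)%:C)).
(* The boundary values are put in by hand: for [y] in [B] the sampled functional looks only from the
   first mesh point on, so [A n y] need not be [v y]. *)
pose L n y := if B y then v y else A n y.
have step n : \sum_y ((Pt (mesh R n) x y)%:C * e n y - (x == y)%:R) *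
    (mesh R n)^-1%:C * L n y = 0.
  transitivity ((mesh R n)^-1%:C * (\sum_y (Pt (mesh R n) x y)%:C * e n y * L n y
      - \sum_y (x == y)%:R * L n y)).
    rewrite -sumrB mulr_sumr; apply: eq_bigr => y _; ring.
  rewrite [X in _ - X](bigD1 x) //= eqxx mul1r [X in _ - (_ + X)]big1 ?addr0.
    rewrite {2}/L (negbTE Bx) /A grid_lst_lim_first_step ?mesh_gt0 //.
    rewrite (_ : _ - _ = 0) ?mulr0 //; apply/eqP; rewrite subr_eq0; apply/eqP.
    apply: eq_bigr => y _; rewrite -mulrA; congr (_ * _); rewrite /e /L.
    by case: (B y); rewrite ?mul1r.
  by move=> y yx; rewrite eq_sym (negbTE yx) mul0r.
have ce y : ccvg (e ^~ y) 1.
  rewrite /e; case: (B y); first exact: ccvg_cst.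
  rewrite -cexp0 (_ : 0 = - (s * (0 * g y)%:C)); last by rewrite mul0r mulr0 oppr0.
  by apply: ccvg_cexp; apply: cvgM; [exact: mesh_cvg|exact: cvg_cst].
have cL y : ccvg (L ^~ y) (if B y then v y else hit_lst y).
  by rewrite /L; case: (B y); [exact: ccvg_cst|exact: cA].
suff cS : ccvg (fun n => \sum_y ((Pt (mesh R n) x y)%:C * e n y - (x == y)%:R) *
    (mesh R n)^-1%:C * L n y)
    (\sum_y ((Q x y)%:C - (x == y)%:R * (s * (g x)%:C)) *
      (if B y then v y else hit_lst y)).
  by apply: (ccvg_unique cS); under eq_fun do rewrite step; exact: ccvg_cst.
apply: ccvg_sum => y; apply: ccvgM => //.
(* The quotient splits so that the first summand tends to the entry of [Q], while the second lives
   on the diagonal and tends to [- (s * g x)]. *)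
rewrite (_ : (fun n => _) = (fun n =>
    ((Pt (mesh R n) x y - (x == y)%:R) / mesh R n)%:C * e n y +
    (x == y)%:R * ((e n y - 1) * (mesh R n)^-1%:C))); last first.
  by apply/funext => n; rewrite rmorphM rmorphB rmorph_nat /=; ring.
rewrite -mulrN -[X in ccvg _ (X + _)]mulr1; apply: ccvgD.
  apply: ccvgM => //; apply: ccvg_real.
  have /cvg_at_rightP/(_ (mesh R)) := @Pt_Q x y; apply.
  by split => [n|]; [exact: mesh_gt0|exact: mesh_cvg].
have [<-|xy] := eqVneq x y; last first.
  by rewrite mul0r; under eq_fun do rewrite mul0r; exact: ccvg_cst.
apply: ccvgM; first exact: ccvg_cst.
rewrite /e (negbTE Bx).
under eq_fun do rewrite (mulrC (mesh R _)) rmorphM mulrA.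
by apply: cexp_quotient; [exact: mesh_gt0|exact: mesh_cvg].
Qed.

End VanishingMesh.
End FirstStep.

(** * Block equations and their elimination *)

Section States.
Variables (N : nat) (K : nat -> nat).

Lemma level_st n (i : 'I_(K n).+1) : (n <= N)%N -> level (st N i) = n :> nat.
Proof. by move=> nN; rewrite /level /= inordK. Qed.

Lemma st_tagged (x : state N K) : st N (tagged x : 'I_(K (tag x)).+1) = x.
Proof.
case: x => l i; rewrite /st /=.
have H (l' : 'I_N.+1) : l' = l ->
    @Tagged _ l' (fun l => 'I_(K l).+1) (inord i) = existT _ l i.
  by move=> ->; rewrite inord_val.
exact/H/inord_val.
Qed.

Lemma st_inj n : (n <= N)%N -> injective (@st N K n).
Proof.
move=> nN i j ij; have val_st (k : 'I_(K n).+1) : tagged (st N k) = k :> nat.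
  by rewrite /= inordK //= inordK.
by apply: val_inj; rewrite /= -!val_st ij.
Qed.

Lemma sum_state (V : nmodType) (F : state N K -> V) :
  \sum_x F x = \sum_(l < N.+1) \sum_(i < (K l).+1) F (st N i).
Proof.
rewrite sig_big_dep /=; apply: eq_big => // x _.
by rewrite -[in LHS](st_tagged x).
Qed.

End States.

Lemma sum_ord2 (V : nmodType) n (F : nat -> V) : (1 < n)%N ->
  (forall l, (1 < l < n)%N -> F l = 0) -> \sum_(l < n) F l = F 0%N + F 1%N.
Proof.
case: n => [|[|n]] // _ F0; rewrite !big_ord_recl /= big1 ?addr0 // => i _.
by apply: F0; rewrite /= !ltnS ltn_ord.
Qed.

Lemma sum_ord3 (V : nmodType) n a (F : nat -> V) : (a.+2 < n)%N ->
  (forall l, (l < n)%N -> (l < a)%N || (a.+2 < l)%N -> F l = 0) ->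
  \sum_(l < n) F l = F a + F a.+1 + F a.+2.
Proof.
move=> an F0; rewrite -(big_mkord xpredT F) (big_cat_nat (n := a)) //=; last first.
  by rewrite ltnW // ltnW // ltnW.
rewrite big_nat big1 ?add0r => [|i /andP[_ ia]]; last first.
  by apply: F0; rewrite ?ia // (ltn_trans ia) // ltnW // ltnW.
rewrite big_ltn ?(ltnW (ltnW an)) // big_ltn ?(ltnW an) // big_ltn // addrA addrA.
by rewrite big_nat big1 ?addr0 // => i /andP[ai iN]; apply: F0; rewrite ?ai ?orbT.
Qed.

Section BlockEquations.
Variables (R : realType) (N : nat) (K : nat -> nat).
Variables (Q : state N K -> state N K -> R) (c : state N K -> R).
Variables (d : measure_display) (T : measurableType d).
Variables (P : state N K -> probability T R) (Z : R -> T -> state N K).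
Variables (A : {set 'I_N.+1}) (s : R[i]).
Hypothesis Q_generator : qbd_generator Q.
Hypothesis c_ge0 : forall x, 0 <= c x.
Hypothesis Z_chain : markov_chain P Z Q.
Hypothesis s_ge0 : 0 <= complex.Re s.

Let L n m := lst P Z c A s n m.
Let M m := Mblock Q c A s L m.

Lemma lst_harmonic n m (i : 'I_(K n).+1) (j : 'I_(K m).+1) :
  (n < m)%N -> (m <= N)%N ->
  \sum_(l < N.+1) \sum_(i' < (K l).+1)
     ((Q (st N i) (st N i'))%:C - (st N i == st N i')%:R *
       (s * (c (st N i) * (inord n \in A)%:R)%:C)) *
     (if l == m :> nat then (st N i' == st N j)%:R else L l m i' j) = 0.
Proof.
move=> nm mN; have nN : (n <= N)%N := ltnW (leq_trans nm mN).
have [Zm Zr Zs [Pt [_ _ _ _ PtQ] ZM]] := Z_chain.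
pose B (x : state N K) := level x == m :> nat.
pose g (x : state N K) := c x * (level x \in A)%:R.
pose v (x : state N K) : R[i] := (x == st N j)%:R.
have g0 x : 0 <= g x by rewrite mulr_ge0 // ler0n.
(* There are finitely many states, so the sum of all cost rates is an upper bound. *)
have gM x : g x <= \sum_y g y by rewrite (bigD1 x) //= lerDl sumr_ge0.
have v1 x : `|v x| <= 1 by rewrite /v; case: (_ == _); rewrite ?normr1 ?normr0.
have Bi : ~~ B (st N i) by rewrite /B level_st // ltn_eqF.
have := @hit_lst_harmonic R _ d T P Z Pt Zm Zs ZM B g s v s_ge0 g0 v1 Q _ PtQ
  (fun w t => @Zr w t) gM (st N i) Bi.
rewrite sum_state => H; rewrite -[RHS]H; apply: eq_bigr => l _; apply: eq_bigr => i' _.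
rewrite /g /B level_st ?leq_ord //; congr (_ * _).
case: (l == m :> nat); first reflexivity.
rewrite [L _ _]/L /lst mxE; apply: (congr1 (cexpectation (P (st N i')))).
apply/funext => w; rewrite /hitting_time /cost /v.
rewrite (_ : [set t | 0 < t /\ level (Z t w) = m :> nat] =
             [set t | 0 < t /\ level (Z t w) == m :> nat]) //.
by apply/seteqP; split => t /= [t0 /eqP].
Qed.

(** Transforms towards level [m] with the identity as boundary value at [m]. The entries for [l]
    above [m] are harmless: a row of level below [m] meets them with a zero block of [Q]. *)
Let Lhat m l : 'M[R[i]]_((K l).+1, (K m).+1) :=
  \matrix_(i, j) if l == m then (st N i == st N j)%:R else L l m i j.

Local Lemma LhatE m l : (l < m)%N -> Lhat m l = L l m.
Proof. by move=> /ltn_eqF lm; apply/matrixP => i j; rewrite mxE lm. Qed.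

Local Lemma Lhat_id m : (m <= N)%N -> Lhat m m = 1%:M.
Proof.
move=> mN; apply/matrixP => i j; rewrite !mxE eqxx.
by rewrite (inj_eq (st_inj mN)).
Qed.

Local Lemma block_harmonic n m : (n < m)%N -> (m <= N)%N ->
  \sum_(l < N.+1) Qblock Q n l *m Lhat m l =
  (s * (inord n \in A)%:R) *: Cblock c n *m L n m.
Proof.
move=> nm mN; have nN : (n <= N)%N := ltnW (leq_trans nm mN).
apply/matrixP => i j; rewrite summxE.
have := lst_harmonic i j nm mN.
under eq_bigr do under eq_bigr do rewrite mulrBl.
under eq_bigr do rewrite sumrB.
rewrite sumrB => /eqP; rewrite subr_eq0 => /eqP H.
transitivity (\sum_(l < N.+1) \sum_(i' < (K l).+1) (Q (st N i) (st N i'))%:C *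
  (if l == m :> nat then (st N i' == st N j)%:R else L l m i' j)).
  by apply: eq_bigr => l _; rewrite mxE; apply: eq_bigr => i' _; rewrite !mxE.
have nN' : (n < N.+1)%N by [].
rewrite {}H (bigD1 (Ordinal nN')) //= [X in _ + X]big1 ?addr0 => [|l ln]; last first.
  rewrite big1 // => i' _; rewrite (_ : (st N i == st N i') = false) ?mul0r //.
  apply/eqP => /(congr1 (fun x => nat_of_ord (level x))).
  rewrite !level_st ?leq_ord // => nl; move: ln; case/negP; apply/eqP/val_inj.
  by rewrite /= nl.
rewrite (bigD1 i) //= big1 ?addr0 => [|i' i'i]; last first.
  by rewrite (inj_eq (st_inj nN)) eq_sym (negbTE i'i) !mul0r.
rewrite eqxx mul1r (ltn_eqF nm) -scalemxAl mxE mul_diag_mx !mxE rmorphM rmorph_nat /=.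
by rewrite -!mulrA; congr (_ * _); rewrite mulrA (mulrC (c _)%:C) mulrA.
Qed.

Local Lemma Qblock_far n l : (n <= N)%N -> (l <= N)%N ->
  (n.+1 < l)%N || (l.+1 < n)%N -> Qblock Q n l = 0.
Proof.
move=> nN lN nl; have [_ _ Q0] := Q_generator.
by apply/matrixP => i j; rewrite !mxE Q0 // !level_st.
Qed.

Local Lemma block_harmonic0 m : (0 < m)%N -> (m <= N)%N ->
  M 0 *m L 0 m = - (Qblock Q 0 1 *m Lhat m 1).
Proof.
move=> m0 mN; have := block_harmonic m0 mN.
rewrite (sum_ord2 (F := fun l => Qblock Q 0 l *m Lhat m l)); last 2 first.
- by rewrite ltnS (leq_trans m0).
- by move=> l /andP[l1 lN]; rewrite Qblock_far ?mul0mx // ?l1.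
rewrite (LhatE m0).
rewrite /M /Mblock /= mulmxBl => <-.
by rewrite opprD addrA subrr add0r.
Qed.

Local Lemma block_harmonicS n m : (n.+1 < m)%N -> (m <= N)%N ->
  Qblock Q n.+1 n *m L n m + (Qblock Q n.+1 n.+1
    - (s * (inord n.+1 \in A)%:R) *: Cblock c n.+1) *m L n.+1 m =
  - (Qblock Q n.+1 n.+2 *m Lhat m n.+2).
Proof.
move=> nm mN; have := block_harmonic nm mN.
rewrite (sum_ord3 (a := n) (F := fun l => Qblock Q n.+1 l *m Lhat m l)); last 2 first.
- by rewrite ltnS (leq_trans nm).
- move=> l lN nl; rewrite Qblock_far ?mul0mx //; first exact: leq_trans (ltnW nm) mN.
  by rewrite ltnS orbC.
rewrite (LhatE nm) (LhatE (ltnW nm)) mulmxBl => <-.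
by rewrite addrA opprD addrA subrr add0r.
Qed.

(** All targets [m] are treated at once. At level [n], the target [n.+1] gives [L n n.+1]
    explicitly, and the target [m] then factors as [L n n.+1 *m L n.+1 m]. Inserted into row [n.+1],
    this factorization turns the term from below into the correction that makes up [M n.+1]. *)
Local Lemma Mblock_elimination n m : (n < m)%N -> (m <= N)%N ->
  (forall l, (l < n)%N -> M l \in unitmx) ->
  M n *m L n m = - (Qblock Q n n.+1 *m Lhat m n.+1).
Proof.
elim: n m => [|n IH] m nm mN Mu; first exact: block_harmonic0.
have IH' := IH _ _ _ (fun l ln => Mu l (ltnW ln)).
have Mn : M n \in unitmx by exact: Mu.
have solve k : (n < k)%N -> (k <= N)%N ->
    L n k = - (invmx (M n) *m Qblock Q n n.+1) *m Lhat k n.+1.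
  move=> nk kN; rewrite mulNmx -mulmxA -mulmxN -IH' //.
  by rewrite mulmxA mulVmx // mul1mx.
have step : L n n.+1 = - (invmx (M n) *m Qblock Q n n.+1).
  by rewrite solve // ?Lhat_id ?mulmx1 // (leq_trans (ltnW nm)).
have fact : L n m = L n n.+1 *m L n.+1 m.
  by rewrite step -(LhatE nm); apply: solve => //; exact: ltnW.
rewrite -block_harmonicS // fact mulmxA -mulmxDl addrC; congr (_ *m _).
Qed.

Lemma Mblock_lst n : (n < N)%N -> (forall l, (l < n)%N -> M l \in unitmx) ->
  M n *m L n n.+1 = - Qblock Q n n.+1.
Proof. by move=> nN Mu; rewrite Mblock_elimination // Lhat_id // mulmx1. Qed.

(** The eliminated equations for the targets [m] and [n.+1] have the same coefficient [M n], which
    cancels. *)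
Lemma lst_first_level n m : (n.+1 < m)%N -> (m <= N)%N ->
  (forall l, (l <= n)%N -> M l \in unitmx) -> L n m = L n n.+1 *m L n.+1 m.
Proof.
move=> nm mN Mu; have Mn : M n \in unitmx by exact: Mu.
have Mu' l : (l < n)%N -> M l \in unitmx by move=> /ltnW; exact: Mu.
have nN : (n < N)%N by rewrite (leq_trans (ltnW nm)).
have := Mblock_elimination (ltnW nm) mN Mu'.
rewrite (LhatE nm) -mulNmx -(Mblock_lst nN Mu') -mulmxA.
by move=> /(congr1 (mulmx (invmx (M n)))); rewrite !mulKmx.
Qed.

(** Elimination splits a passage at its first intermediate level, the recursion to be differentiated
    at its last one. Associativity converts one into the other, by induction on the distance. *)
Lemma lst_last_level n m : (n < m)%N -> (m < N)%N ->
  (forall l, (l <= m)%N -> M l \in unitmx) -> L n m.+1 = L n m *m L m m.+1.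
Proof.
move=> nm; have [e] : exists e, m = (n + e.+1)%N.
  by exists (m - n.+1)%N; rewrite addnS -addSn subnKC.
elim: e n {nm} => [|e IH] n mE mN Mu.
  rewrite addn1 in mE; subst m.
  by apply: lst_first_level => // l ln; apply: Mu; exact: leqW.
have nm : (n.+1 < m)%N by rewrite mE addnS ltnS addnS ltnS leq_addr.
have Mu' l : (l <= n)%N -> M l \in unitmx.
  by move=> ln; apply: Mu; rewrite (leq_trans ln) // ltnW // ltnW.
rewrite lst_first_level ?(leqW nm) // (lst_first_level nm (ltnW mN)) //.
by rewrite -mulmxA -IH // mE addSnnS.
Qed.

End BlockEquations.

(** * Differentiation of complex matrices *)

Section Smoothness.
Variables (R : realType) (V : normedModType R) (x : V).
Implicit Types (f g : V -> R) (F G : V -> R[i]).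

(* Unlike [differentiable], visibly invariant under changes away from [x], and
   enough for the determinant to stay nonzero near [x]. *)
Definition smooth_at f :=
  f y @[y --> x] --> f x /\ forall v, derivable f x v.

Lemma differentiable_smooth_at f : differentiable f x -> smooth_at f.
Proof.
move=> fx; split; first exact: differentiable_continuous.
by move=> v; exact: diff_derivable.
Qed.

Lemma near_smooth_at f g : {near x, f =1 g} -> smooth_at f -> smooth_at g.
Proof.
move=> fg [cf df]; split; last by move=> v; exact: near_eq_derivable (df v).
rewrite -(nbhs_singleton fg).
by apply: cvg_trans cf; apply: near_eq_cvg; apply: filterS fg => y ->.
Qed.

Lemma smooth_at_cst (a : R) : smooth_at (fun=> a).
Proof. by split => [|v]; [exact: cvg_cst|exact: derivable_cst]. Qed.

Lemma smooth_atD f g : smooth_at f -> smooth_at g -> smooth_at (fun y => f y + g y).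
Proof.
by move=> [cf df] [cg dg]; split => [|v]; [exact: cvgD|exact: derivableD].
Qed.

Lemma smooth_atB f g : smooth_at f -> smooth_at g -> smooth_at (fun y => f y - g y).
Proof.
by move=> [cf df] [cg dg]; split => [|v]; [exact: cvgB|exact: derivableB].
Qed.

Lemma smooth_atM f g : smooth_at f -> smooth_at g -> smooth_at (fun y => f y * g y).
Proof.
by move=> [cf df] [cg dg]; split => [|v]; [exact: cvgM|exact: derivableM].
Qed.

Lemma smooth_atV f : f x != 0 -> smooth_at f -> smooth_at (fun y => (f y)^-1).
Proof.
by move=> f0 [cf df]; split => [|v]; [exact: cvgV|exact: derivableV].
Qed.

Definition csmooth_at F :=
  smooth_at (fun y => complex.Re (F y)) /\ smooth_at (fun y => complex.Im (F y)).

Lemma near_csmooth_at F G : {near x, F =1 G} -> csmooth_at F -> csmooth_at G.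
Proof.
move=> FG [dr di]; split.
  by apply: near_smooth_at dr; apply: filterS FG => y ->.
by apply: near_smooth_at di; apply: filterS FG => y ->.
Qed.

Lemma csmooth_at_cst (a : R[i]) : csmooth_at (fun=> a).
Proof. by split; apply: smooth_at_cst. Qed.

Lemma csmooth_atD F G : csmooth_at F -> csmooth_at G ->
  csmooth_at (fun y => F y + G y).
Proof.
move=> [Fr Fi] [Gr Gi]; split.
  by under eq_fun do rewrite ReD; apply: smooth_atD.
by under eq_fun do rewrite ImD; apply: smooth_atD.
Qed.

Lemma csmooth_atM F G : csmooth_at F -> csmooth_at G ->
  csmooth_at (fun y => F y * G y).
Proof.
move=> [Fr Fi] [Gr Gi]; split.
  by under eq_fun do rewrite ReM; apply: smooth_atB; apply: smooth_atM.
by under eq_fun do rewrite ImM; apply: smooth_atD; apply: smooth_atM.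
Qed.

Lemma csmooth_at_sum (I : Type) (r : seq I) (F : I -> V -> R[i]) :
  (forall i, csmooth_at (F i)) -> csmooth_at (fun y => \sum_(i <- r) F i y).
Proof.
move=> dF; elim: r => [|i r IH].
  by under eq_fun do rewrite big_nil; apply: csmooth_at_cst.
by under eq_fun do rewrite big_cons; exact: csmooth_atD (dF i) IH.
Qed.

Lemma csmooth_at_prod (I : Type) (r : seq I) (F : I -> V -> R[i]) :
  (forall i, csmooth_at (F i)) -> csmooth_at (fun y => \prod_(i <- r) F i y).
Proof.
move=> dF; elim: r => [|i r IH].
  by under eq_fun do rewrite big_nil; apply: csmooth_at_cst.
by under eq_fun do rewrite big_cons; exact: csmooth_atM (dF i) IH.
Qed.

(** The inverse is the conjugate divided by the squared modulus, which reduces the claim to real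
    quotients. *)
Lemma csmooth_atV F : F x != 0 -> csmooth_at F -> csmooth_at (fun y => (F y)^-1).
Proof.
move=> F0 [Fr Fi]; pose n2 z : R := complex.Re z ^+ 2 + complex.Im z ^+ 2.
have n20 : n2 (F x) != 0.
  rewrite paddr_eq0 ?sqr_ge0 // !sqrf_eq0; move: F0; case: (F x) => a b /=.
  by rewrite eq_complex.
have dn2 : smooth_at (fun y => (n2 (F y))^-1).
  exact: smooth_atV n20 (smooth_atD (smooth_atM Fr Fr) (smooth_atM Fi Fi)).
split.
  rewrite (_ : (fun y => _) = fun y => complex.Re (F y) * (n2 (F y))^-1).
    exact: smooth_atM.
  by apply/funext => y; rewrite /n2; case: (F y).
rewrite (_ : (fun y => _) = fun y => 0 - complex.Im (F y) * (n2 (F y))^-1).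
  by apply: smooth_atB; [exact: smooth_at_cst|exact: smooth_atM].
by apply/funext => y; rewrite /n2 sub0r; case: (F y).
Qed.

Lemma csmooth_at_neq0 F : csmooth_at F -> F x != 0 -> \forall y \near x, F y != 0.
Proof.
move=> [[cr _] [ci _]]; have H z : (z != 0) = (complex.Re z != 0) || (complex.Im z != 0).
  by case: z => a b; rewrite eq_complex /= negb_and.
rewrite H => /orP[r0|i0].
  by apply: filterS (cvgr_neq0 _ cr r0) => y ry; rewrite H ry.
by apply: filterS (cvgr_neq0 _ ci i0) => y iy; rewrite H iy orbT.
Qed.

Definition mxsmooth_at a b (F : V -> 'M[R[i]]_(a, b)) :=
  forall i j, csmooth_at (fun y => F y i j).

Lemma near_mxsmooth_at a b (F G : V -> 'M[R[i]]_(a, b)) :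
  {near x, F =1 G} -> mxsmooth_at F -> mxsmooth_at G.
Proof.
move=> FG dF i j; apply: near_csmooth_at (dF i j).
by apply: filterS FG => y ->.
Qed.

Lemma mxsmooth_at_cst a b (C : 'M[R[i]]_(a, b)) : mxsmooth_at (fun=> C).
Proof. by move=> i j; exact: csmooth_at_cst. Qed.

Lemma mxsmooth_atD a b (F G : V -> 'M[R[i]]_(a, b)) :
  mxsmooth_at F -> mxsmooth_at G -> mxsmooth_at (fun y => F y + G y).
Proof.
by move=> dF dG i j; under eq_fun do rewrite mxE; exact: csmooth_atD.
Qed.

Lemma mxsmooth_atM a b n (F : V -> 'M[R[i]]_(a, n)) (G : V -> 'M[R[i]]_(n, b)) :
  mxsmooth_at F -> mxsmooth_at G -> mxsmooth_at (fun y => F y *m G y).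
Proof.
move=> dF dG i j; under eq_fun do rewrite mxE.
by apply: csmooth_at_sum => k; exact: csmooth_atM.
Qed.

Lemma csmooth_at_det n (F : V -> 'M[R[i]]_n) : mxsmooth_at F ->
  csmooth_at (fun y => \det (F y)).
Proof.
move=> dF; apply: csmooth_at_sum => s; apply: csmooth_atM.
  exact: csmooth_at_cst.
by apply: csmooth_at_prod => i; exact: dF.
Qed.

Lemma near_unitmx n (F : V -> 'M[R[i]]_n) : mxsmooth_at F -> F x \in unitmx ->
  \forall y \near x, F y \in unitmx.
Proof.
move=> dF; rewrite unitmxE unitfE => F0.
apply: filterS (csmooth_at_neq0 (csmooth_at_det dF) F0) => y.
by rewrite unitmxE unitfE.
Qed.

(** The adjugate formula is rational in the entries. [invmx] follows it on invertible matrices only,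
    hence the passage to a neighbourhood. *)
Lemma mxsmooth_at_inv n (F : V -> 'M[R[i]]_n) : mxsmooth_at F -> F x \in unitmx ->
  mxsmooth_at (fun y => invmx (F y)).
Proof.
move=> dF Fx.
apply: (@near_mxsmooth_at _ _ (fun y => (\det (F y))^-1 *: \adj (F y))).
  by apply: filterS (near_unitmx dF Fx) => y Fy; rewrite /invmx Fy.
move=> i j; under eq_fun do rewrite !mxE.
apply: csmooth_atM.
  by apply: csmooth_atV; [rewrite -unitfE -unitmxE|exact: csmooth_at_det].
apply: csmooth_atM; first exact: csmooth_at_cst.
apply: csmooth_at_det => k l; under eq_fun do rewrite !mxE; exact: dF.
Qed.

End Smoothness.

(** * The product rule with Kronecker factors *)

Section MatrixProductRule.
Variables (R : realType) (p : nat) (x : 'rV[R]_p).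

Let cderive (v : 'rV[R]_p) (F : 'rV[R]_p -> R[i]) : R[i] :=
  ('D_v (fun y => complex.Re (F y) : R) x) +i* ('D_v (fun y => complex.Im (F y) : R) x).

Local Lemma cderiveD v F G : csmooth_at x F -> csmooth_at x G ->
  cderive v (fun y => F y + G y) = cderive v F + cderive v G.
Proof.
move=> [[_ Fr] [_ Fi]] [[_ Gr] [_ Gi]].
apply: ReIm_eq.
  rewrite ReD; apply: etrans (deriveD (Fr v) (Gr v)).
  by congr ('D_v _ x); apply/funext => y; rewrite ReD.
rewrite ImD; apply: etrans (deriveD (Fi v) (Gi v)).
by congr ('D_v _ x); apply/funext => y; rewrite ImD.
Qed.

Local Lemma cderive_sum v (I : Type) (r : seq I) (F : I -> 'rV[R]_p -> R[i]) :
  (forall i, csmooth_at x (F i)) ->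
  cderive v (fun y => \sum_(i <- r) F i y) = \sum_(i <- r) cderive v (F i).
Proof.
move=> dF; elim: r => [|i r IH].
  rewrite big_nil /cderive; under eq_fun do rewrite big_nil.
  by under [in X in _ +i* X]eq_fun do rewrite big_nil; rewrite !derive_cst.
rewrite big_cons -IH -cderiveD //; last exact: csmooth_at_sum.
by congr (cderive v _); apply/funext => y; rewrite big_cons.
Qed.

Local Lemma cderiveM v F G : csmooth_at x F -> csmooth_at x G ->
  cderive v (fun y => F y * G y) = cderive v F * G x + F x * cderive v G.
Proof.
move=> [[_ Fr] [_ Fi]] [[_ Gr] [_ Gi]]; apply: ReIm_eq.
  transitivity ('D_v ((fun y => complex.Re (F y)) * (fun y => complex.Re (G y))
    - (fun y => complex.Im (F y)) * (fun y => complex.Im (G y)) : _ -> R) x).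
    by congr ('D_v _ x); apply/funext => y; rewrite ReM.
  rewrite (deriveB (derivableM (Fr v) (Gr v)) (derivableM (Fi v) (Gi v))).
  rewrite (deriveM (Fr v) (Gr v)) (deriveM (Fi v) (Gi v)) ReD !ReM /=.
  do 4 move: ('D_v _ x) => ?; rewrite /GRing.scale /=; ring.
transitivity ('D_v ((fun y => complex.Re (F y)) * (fun y => complex.Im (G y))
    + (fun y => complex.Im (F y)) * (fun y => complex.Re (G y)) : _ -> R) x).
  by congr ('D_v _ x); apply/funext => y; rewrite ImM.
rewrite (deriveD (derivableM (Fr v) (Gi v)) (derivableM (Fi v) (Gr v))).
rewrite (deriveM (Fr v) (Gi v)) (deriveM (Fi v) (Gr v)) ImD !ImM /=.
do 4 move: ('D_v _ x) => ?; rewrite /GRing.scale /=; ring.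
Qed.

Local Lemma cderiveN v F : csmooth_at x F ->
  cderive v (fun y => - F y) = - cderive v F.
Proof.
move=> [[_ Fr] [_ Fi]]; apply: ReIm_eq.
  apply: etrans (deriveN (Fr v)).
  by congr ('D_v _ x); apply/funext => y; rewrite !fctE; case: (F y).
apply: etrans (deriveN (Fi v)).
by congr ('D_v _ x); apply/funext => y; rewrite !fctE; case: (F y).
Qed.

Lemma mxsmooth_at_derivable a b (F : 'rV[R]_p -> 'M[R[i]]_(a, b)) :
  mxsmooth_at x F -> mx_derivable F x.
Proof. by move=> dF r i j; have [[_ dr] [_ di]] := dF i j; split. Qed.

Lemma near_mx_deriv a b (F G : 'rV[R]_p -> 'M[R[i]]_(a, b)) :
  {near x, F =1 G} -> mx_deriv F x = mx_deriv G x.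
Proof.
move=> FG; apply/matrixP => i j; rewrite !mxE; congr (_ +i* _);
  by apply: near_eq_derive; apply: filterS FG => y ->.
Qed.

Lemma mx_derivD a b (F G : 'rV[R]_p -> 'M[R[i]]_(a, b)) :
  mxsmooth_at x F -> mxsmooth_at x G ->
  mx_deriv (fun y => F y + G y) x = mx_deriv F x + mx_deriv G x.
Proof.
move=> dF dG; apply/matrixP => i j; rewrite !mxE -!/(cderive _ _).
by under eq_fun do rewrite mxE; rewrite cderiveD.
Qed.

Lemma mx_deriv_cst a b (C : 'M[R[i]]_(a, b)) : mx_deriv (fun=> C) x = 0.
Proof. by apply/matrixP => i j; rewrite !mxE !derive_cst. Qed.

Lemma mx_derivN a b (F : 'rV[R]_p -> 'M[R[i]]_(a, b)) :
  mxsmooth_at x F -> mx_deriv (fun y => - F y) x = - mx_deriv F x.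
Proof.
move=> dF; apply/matrixP => i j; rewrite !mxE.
rewrite -!/(cderive _ _).
by under eq_fun do rewrite mxE; rewrite cderiveN.
Qed.

(** The Kronecker factor acts on each of the [p] column blocks separately, which reduces
    concatenated derivatives to one partial derivative at a time. *)
Lemma mul_mx_Ikron a n b (A : 'M[R[i]]_(a, p * n)) (B : 'M[R[i]]_(n, b)) i l :
  (A *m Ikron p B) i l =
  \sum_k A i (mxtens_index ((mxtens_unindex l).1, k)) * B k (mxtens_unindex l).2.
Proof.
case: (mxtens_indexP l) => r j; rewrite mxtens_indexK /=.
rewrite mxE (reindex (@mxtens_index p n)) /=; last first.
  by exists (@mxtens_unindex p n) => u _; [exact: mxtens_indexK|exact: mxtens_unindexK].
transitivity (\sum_q \sum_k A i (mxtens_index (q, k)) *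
    Ikron p B (mxtens_index (q, k)) (mxtens_index (r, j))).
  by rewrite pair_bigA; apply: eq_bigr => -[q k] _.
rewrite (bigD1 r) //= [X in _ + X]big1 ?addr0 => [|q qr].
  by apply: eq_bigr => k _; rewrite /Ikron tensmxE mxE eqxx mul1r.
by apply: big1 => k _; rewrite /Ikron tensmxE mxE (negbTE qr) mul0r mulr0.
Qed.

Lemma mx_derivM a n b (F : 'rV[R]_p -> 'M[R[i]]_(a, n))
    (G : 'rV[R]_p -> 'M[R[i]]_(n, b)) :
  mxsmooth_at x F -> mxsmooth_at x G ->
  mx_deriv (fun y => F y *m G y) x =
  mx_deriv F x *m Ikron p (G x) + F x *m mx_deriv G x.
Proof.
move=> dF dG; apply/matrixP => i l; rewrite [RHS]mxE mul_mx_Ikron [X in _ + X]mxE.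
rewrite -big_split mxE mxE -/(cderive _ _) /=.
under [in RHS]eq_bigr do rewrite !mxE mxtens_indexK -!/(cderive _ _) /=.
under eq_fun do rewrite mxE.
rewrite cderive_sum => [|k]; last exact: csmooth_atM.
by apply: eq_bigr => k _; rewrite cderiveM.
Qed.

Lemma Ikron_mul a n b (A : 'M[R[i]]_(a, n)) (B : 'M[R[i]]_(n, b)) :
  Ikron p (A *m B) = Ikron p A *m Ikron p B.
Proof. by rewrite /Ikron tensmx_mul mul1mx. Qed.

Lemma IkronN a b (A : 'M[R[i]]_(a, b)) : Ikron p (- A) = - Ikron p A.
Proof. by apply/matrixP => i j; rewrite !mxE mulrN. Qed.

End MatrixProductRule.

(** * Derivatives of the transforms *)

Section Differentiation.
Variables (R : realType) (N : nat) (K : nat -> nat) (p : nat).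
Variables (D : set 'rV[R]_p) (Q : 'rV[R]_p -> state N K -> state N K -> R).
Variables (c : state N K -> R) (d : measure_display).
Variables (T : 'rV[R]_p -> measurableType d).
Variables (P : forall th : 'rV[R]_p, state N K -> probability (T th) R).
Variables (Z : forall th : 'rV[R]_p, R -> T th -> state N K).
Variables (A : {set 'I_N.+1}) (s : R[i]) (th0 : 'rV[R]_p).
Hypothesis D_open : open D.
Hypothesis Q_generator : forall th, D th -> qbd_generator (Q th).
Hypothesis Q_diff : forall th, D th -> forall x y : state N K,
  differentiable (fun t => Q t x y : R) th.
Hypothesis c_ge0 : forall x, 0 <= c x.
Hypothesis Z_markov : forall th, D th -> markov_chain (P th) (@Z th) (Q th).
Hypothesis s_ge0 : 0 <= complex.Re s.
Hypothesis th0_D : D th0.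

Let L n m th := lst (P th) (@Z th) c A s n m.
Let Qb n m th := Qblock (Q th) n m.
Let M m th := Mblock (Q th) c A s (fun n m => L n m th) m.

Variable m0 : nat.
Hypothesis m0_ltN : (m0 < N)%N.
Hypothesis M_unit : forall m, (m <= m0)%N -> M m th0 \in unitmx.

Local Lemma near_D : \forall th \near th0, D th.
Proof. exact: open_nbhs_nbhs. Qed.

Local Lemma Qb_smooth n m : mxsmooth_at th0 (Qb n m).
Proof.
move=> i j; rewrite /Qb; split; under eq_fun do rewrite mxE /=.
  by apply: differentiable_smooth_at; exact: Q_diff.
exact: smooth_at_cst.
Qed.

(** The three claims need each other: the smoothness of [M m] uses that of the transform one level
    below, it makes invertibility persist nearby, and there the transform equals the smooth solution
    of its linear equation. *)
Local Lemma lst_smooth_near m : (m <= m0)%N ->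
  [/\ mxsmooth_at th0 (M m), mxsmooth_at th0 (L m m.+1)
    & \forall th \near th0, forall l, (l <= m)%N -> M l th \in unitmx].
Proof.
have solve m' : (m' <= m0)%N -> mxsmooth_at th0 (M m') ->
    (\forall th \near th0, forall l, (l < m')%N -> M l th \in unitmx) ->
    [/\ mxsmooth_at th0 (M m'), mxsmooth_at th0 (L m' m'.+1)
      & \forall th \near th0, forall l, (l <= m')%N -> M l th \in unitmx].
  move=> mm dM Ml.
  have Mm : \forall th \near th0, forall l, (l <= m')%N -> M l th \in unitmx.
    apply: filterS2 Ml (near_unitmx dM (M_unit mm)) => th Ml Mm l.
    by rewrite leq_eqVlt => /predU1P[->|/Ml].
  split => //.
  apply: (@near_mxsmooth_at _ _ _ _ _
    (fun th => invmx (M m' th) *m ((- 1%:M) *m Qb m' m'.+1 th))); last first.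
    apply: mxsmooth_atM; first exact: mxsmooth_at_inv (M_unit mm).
    by apply: mxsmooth_atM; [exact: mxsmooth_at_cst|exact: Qb_smooth].
  apply: filterS2 near_D Mm => th Dth Mth.
  rewrite mulNmx mul1mx /Qb -(@Mblock_lst _ _ _ (Q th) c d _ (P th) (@Z th) A s
    (Q_generator Dth) c_ge0 (Z_markov Dth) s_ge0) ?(leq_ltn_trans mm) //.
    by rewrite mulKmx // Mth.
  by move=> l lm; apply: Mth; exact: ltnW.
elim: m => [_|m IH mm].
  apply: solve => //; last by apply: filterS near_D => th _ l; rewrite ltn0.
  apply: mxsmooth_atD; [exact: Qb_smooth|exact: mxsmooth_at_cst].
have [_ dL Mu] := IH (ltnW mm).
apply: solve => //.
apply: mxsmooth_atD; last by apply: mxsmooth_atM; [exact: Qb_smooth|].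
apply: mxsmooth_atD; [exact: Qb_smooth|exact: mxsmooth_at_cst].
Qed.

Local Lemma near_lst_last_level n m : (n < m)%N -> (m <= m0)%N ->
  {near th0, (fun th => L n m th *m L m m.+1 th) =1 L n m.+1}.
Proof.
move=> nm mm; have [_ _ Mu] := lst_smooth_near mm.
apply: filterS2 near_D Mu => th Dth Mth.
symmetry; apply: (@lst_last_level _ _ _ (Q th) c d _ (P th) (@Z th) A s
  (Q_generator Dth) c_ge0 (Z_markov Dth) s_ge0) => //.
exact: leq_ltn_trans mm _.
Qed.

Local Lemma lst_smooth n m : (n < m)%N -> (m <= m0.+1)%N -> mxsmooth_at th0 (L n m).
Proof.
elim: m => // m IH; rewrite ltnS leq_eqVlt => /predU1P[-> mm|nm mm].
  by have [_ ? _] := lst_smooth_near mm.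
apply: (near_mxsmooth_at (near_lst_last_level nm mm)).
apply: mxsmooth_atM; first exact: IH (leqW mm).
by have [_ ? _] := lst_smooth_near mm.
Qed.

(** The equation [M L = - Q] is differentiated and solved for the derivative of [L], so no
    derivative of an inverse is needed. Replacing the remaining [L] by its solution produces the
    Kronecker factors and the positive sign of the first term. *)
Local Lemma mx_deriv_lst m : (m <= m0)%N ->
  mx_deriv (L m m.+1) th0 =
    invmx (M m th0) *m mx_deriv (M m) th0 *m Ikron p (invmx (M m th0)) *m
      Ikron p (Qb m m.+1 th0)
    - invmx (M m th0) *m mx_deriv (Qb m m.+1) th0.
Proof.
move=> mm; have [dM dL Mu] := lst_smooth_near mm.
have E : {near th0, (fun th => M m th *m L m m.+1 th) =1 (fun th => - Qb m m.+1 th)}.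
  apply: filterS2 near_D Mu => th Dth Mth.
  apply: (@Mblock_lst _ _ _ (Q th) c d _ (P th) (@Z th) A s
    (Q_generator Dth) c_ge0 (Z_markov Dth) s_ge0); first exact: leq_ltn_trans mm _.
  by move=> l lm; apply: Mth; exact: ltnW.
have := near_mx_deriv E; rewrite mx_derivM // mx_derivN; last exact: Qb_smooth.
have L0 : L m m.+1 th0 = - (invmx (M m th0) *m Qb m m.+1 th0).
  by rewrite -mulmxN -(nbhs_singleton E) mulKmx // M_unit.
move=> /(congr1 (fun X => invmx (M m th0) *m (X - mx_deriv (M m) th0 *m
  Ikron p (L m m.+1 th0)))).
rewrite [X in _ *m X = _]addrAC subrr add0r (mulKmx (M_unit mm)) => ->.
rewrite L0 IkronN Ikron_mul mulmxN opprK mulmxDr mulmxN addrC !mulmxA.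
by [].
Qed.

(** The cost term is constant in [th] and drops out. *)
Local Lemma mx_deriv_Mblock0 : mx_deriv (M 0) th0 = mx_deriv (Qb 0 0) th0.
Proof.
rewrite /M /Mblock mx_derivD; last exact: mxsmooth_at_cst.
  by rewrite mx_deriv_cst addr0.
exact: Qb_smooth.
Qed.

Local Lemma mx_deriv_MblockS m : (m < m0)%N ->
  mx_deriv (M m.+1) th0 = mx_deriv (Qb m.+1 m.+1) th0
    + mx_deriv (Qb m.+1 m) th0 *m Ikron p (L m m.+1 th0)
    + Qb m.+1 m th0 *m mx_deriv (L m m.+1) th0.
Proof.
move=> mm; have [_ dL _] := lst_smooth_near (ltnW mm).
rewrite -addrA -mx_derivM //; last exact: Qb_smooth.
have dB := mxsmooth_at_cst th0 (- ((s * (inord m.+1 \in A)%:R) *: Cblock c m.+1)).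
have dQ l : mxsmooth_at th0 (Qb m.+1 l) := @Qb_smooth m.+1 l.
rewrite /M /Mblock (mx_derivD (mxsmooth_atD (dQ m.+1) dB) (mxsmooth_atM (dQ m) dL)).
by rewrite (mx_derivD (dQ m.+1) dB) mx_deriv_cst addr0.
Qed.

End Differentiation.

Theorem lemma4 (R : realType) (N : nat) (K : nat -> nat) (p : nat)
    (D : set 'rV[R]_p)
    (Q : 'rV[R]_p -> state N K -> state N K -> R)
    (c : state N K -> R)
    (d : measure_display) (T : 'rV[R]_p -> measurableType d)
    (P : forall th : 'rV[R]_p, state N K -> probability (T th) R)
    (Z : forall th : 'rV[R]_p, R -> T th -> state N K)
    (A : {set 'I_N.+1}) (s : R[i]) (n k : nat) (th0 : 'rV[R]_p)
    (D_open : open D)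
    (Q_generator : forall th, D th -> qbd_generator (Q th))
    (Q_diff : forall th, D th -> forall x y : state N K,
       differentiable (fun t => Q t x y : R) th)
    (c_ge0 : forall x, 0 <= c x)
    (Z_markov : forall th, D th -> markov_chain (P th) (Z th) (Q th))
    (s_ge0 : 0 <= complex.Re s)
    (k_ge2 : (2 <= k)%N) (nk_leN : (n + k <= N)%N)
    (th0_D : D th0) :
  let L n m := fun th => lst (P th) (Z th) c A s n m in
  let Qb n m := fun th => Qblock (Q th) n m in
  let M m := Mblock (Q th0) c A s (fun n m => L n m th0) m in
  (forall m : nat, (m <= n + k - 1)%N -> M m \in unitmx) ->
  [/\ [/\ mx_derivable (L n (n + k)%N) th0,
          mx_derivable (L n (n + k - 1)%N) th0
        & forall m : nat, (m <= n + k - 1)%N -> mx_derivable (L m m.+1) th0],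
      mx_deriv (L n (n + k)%N) th0 =
        mx_deriv (L n (n + k - 1)%N) th0 *m
          Ikron p (L (n + k - 1)%N (n + k)%N th0)
        + L n (n + k - 1)%N th0 *m
          mx_deriv (L (n + k - 1)%N (n + k)%N) th0,
      mx_deriv (L 0%N 1%N) th0 =
        invmx (M 0%N) *m mx_deriv (Qb 0%N 0%N) th0 *m
          Ikron p (invmx (M 0%N)) *m Ikron p (Qb 0%N 1%N th0)
        - invmx (M 0%N) *m mx_deriv (Qb 0%N 1%N) th0
    & forall m' : nat, let m := m'.+1 in (m <= n + k - 1)%N ->
      mx_deriv (L m m.+1) th0 =
        invmx (M m) *m
          (mx_deriv (Qb m m) th0
           + mx_deriv (Qb m m') th0 *m Ikron p (L m' m th0)
           + Qb m m' th0 *m mx_deriv (L m' m) th0) *m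
          Ikron p (invmx (M m)) *m Ikron p (Qb m m.+1 th0)
        - invmx (M m) *m mx_deriv (Qb m m.+1) th0].
Proof.
move=> L Qb M Mu.
have m0E : (n + k)%N = (n + k - 1).+1 by rewrite subn1 prednK // addn_gt0 orbC (ltnW k_ge2).
have nm0 : (n < n + k - 1)%N.
  by have : (n + 2 <= n + k)%N by [rewrite leq_add2l]; rewrite addn2 {1}m0E ltnS.
have m0N : (n + k - 1 < N)%N by rewrite -m0E.
(* With [n + k - 1] abstracted to [m0], the level [n + k] becomes [m0.+1], and the matrix dimensions
   agree without casts. *)
move: (n + k - 1)%N m0E nm0 m0N Mu => m0 -> nm0 m0N Mu.
have smooth := lst_smooth D_open Q_generator Q_diff c_ge0 Z_markov s_ge0 th0_D m0N Mu.
have step := mx_deriv_lst D_open Q_generator Q_diff c_ge0 Z_markov s_ge0 th0_D m0N Mu.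
have Lk := smooth _ _ (ltnW nm0 : (n < m0.+1)%N) (leqnn _).
have Lk1 := smooth _ _ nm0 (leqnSn m0).
have L1 m (mm : (m <= m0)%N) := smooth _ _ (ltnSn m) mm.
split.
- split; [exact: mxsmooth_at_derivable Lk|exact: mxsmooth_at_derivable Lk1|].
  by move=> m /L1; exact: mxsmooth_at_derivable.
- rewrite -(near_mx_deriv (near_lst_last_level D_open Q_generator Q_diff c_ge0
    Z_markov s_ge0 th0_D m0N Mu nm0 (leqnn m0))).
  exact: mx_derivM Lk1 (L1 _ (leqnn m0)).
- by rewrite (step _ (leq0n m0))
    (@mx_deriv_Mblock0 _ _ _ _ _ _ _ _ _ _ _ _ _ _ Q_diff th0_D).
- by move=> m' m mm; rewrite (step _ mm) (mx_deriv_MblockS D_open Q_generator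
    Q_diff c_ge0 Z_markov s_ge0 th0_D m0N Mu mm).
Qed.
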